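(* Let $K$ be an algebraically closed field of characteristic $p$ and let $C\subset \mathbb{G}_m^n$ be a torsion coset of dimension $d\ge 1$ and order $g$. If $p=0$, then $$\# C_T =\frac{T^{d+1}}{(d+1)\zeta(d+1)g}+\begin{cases}O_g(T\log(T))&\text{if }d=1\\O_{d,g}(T^d) &\text{if } d\ge 2\end{cases}\quad\text{as }T\to\infty,$$ and if $p>0$, then $$\#C_T =\frac{(p-1)T^{d+1}}{(p-p^{-d})(d+1)\zeta(d+1)g}+\begin{cases}O_g(T\log(T))&\text{if }d=1\\O_{d,g}(T^d) &\text{if } d\ge 2\end{cases}\quad\text{as }T\to\infty.$$
   Context: $\mathbb G_m^n=(K\setminus\{0\})^n$ with coordinate-wise multiplication; $(\mathbb G_m^n)_{\mathrm{tors}}$ is its set of elements of finite order (torsion points), and $\mathrm{ord}$ denotes the order. A linear torus is an irreducible algebraic subgroup of $\mathbb G_m^n$; a torsion coset is a set $\boldsymbol\zeta G$ with $\boldsymbol\zeta$ a torsion point and $G$ a linear torus. The order of a torsion coset $C$ is $\mathrm{ord}(C)=\min\{\mathrm{ord}(\boldsymbol\eta):\boldsymbol\eta\in C\cap(\mathbb G_m^n)_{\mathrm{tors}}\}$. For $T\ge1$, $C_T=\{\boldsymbol\zeta\in C\cap(\mathbb G_m^n)_{\mathrm{tors}}:\mathrm{ord}(\boldsymbol\zeta)\le T\}$. $\zeta(\cdot)$ in the formulas is the Riemann zeta function. Subscripts on $O$ indicate the quantities the implied constants may depend on. *)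

(* Defs.v *)
From mathcomp Require Import all_boot all_order all_algebra.
From mathcomp Require Import finmap.
From mathcomp Require Import all_classical all_reals all_analysis.
(* Not imported: its notations clash with those of MathComp-Analysis. *)
From mathcomp Require mpoly.

Set Implicit Arguments.
Unset Strict Implicit.
Unset Printing Implicit Defensive.

Import Order.TTheory GRing.Theory Num.Theory.
Import numFieldNormedType.Exports.
Local Open Scope classical_set_scope.
Local Open Scope ring_scope.

(* K^n with the coordinatewise product: the ring operations of
   {ffun 'I_n -> K} are pointwise. *)
Notation Kpow K n := {ffun 'I_n -> K}.

Section Torus.
Variables (K : closedFieldType) (n : nat).
Implicit Types (x y z : Kpow K n) (C G H X Z : set (Kpow K n)).

Definition Gm : set (Kpow K n) := [set x | forall i, x i != 0].

Definition coord_inv x : Kpow K n := [ffun i => (x i)^-1].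

(* Closedness and irreducibility refer to the Zariski topology of G_m^n, i.e.
   the one induced from affine n-space; polynomials and Laurent polynomials
   define the same closed subsets of G_m^n. *)
Definition zero_locus (S : set (mpoly.mpoly n K)) : set (Kpow K n) :=
  [set x | Gm x /\ forall f, S f -> mpoly.meval x f = 0].

Definition zariski_closed Z := exists S, Z = zero_locus S.

Definition irreducible Z :=
  Z !=set0 /\
  forall Z1 Z2, zariski_closed Z1 -> zariski_closed Z2 ->
    Z `<=` Z1 `|` Z2 -> Z `<=` Z1 \/ Z `<=` Z2.

Definition subgroup H :=
  [/\ H `<=` Gm,
      H 1,
      (forall x y, H x -> H y -> H (x * y)) &
      (forall x, H x -> H (coord_inv x))].

Definition linear_torus G :=
  [/\ subgroup G, zariski_closed G & irreducible G].

(* The order of x is m; in particular x is a torsion point. *)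
Definition has_order x (m : nat) :=
  [/\ Gm x, (0 < m)%N, x ^+ m = 1 &
      forall k, (0 < k)%N -> x ^+ k = 1 -> (m <= k)%N].

Definition torsion : set (Kpow K n) := [set x | exists m, has_order x m].

Definition torsion_coset C :=
  exists z G, [/\ torsion z, linear_torus G & C = [set z * x | x in G]].

Definition has_coset_order C (g : nat) :=
  (exists2 x, C x & has_order x g) /\
  (forall x m, C x -> has_order x m -> (g <= m)%N).

(* Chains F 0 < F 1 < ... < F m of irreducible closed subsets of X; the values
   of F beyond m are irrelevant. *)
Definition irreducible_chain X (m : nat) (F : nat -> set (Kpow K n)) :=
  (forall i, (i <= m)%N ->
     [/\ zariski_closed (F i), irreducible (F i) & F i `<=` X]) /\
  (forall i, (i < m)%N -> F i `<` F i.+1).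

(* Krull dimension, for X closed in G_m^n. *)
Definition has_dim X (d : nat) :=
  (exists F, irreducible_chain X d F) /\
  (forall m F, irreducible_chain X m F -> (m <= d)%N).

Definition torsion_upto (R : realType) C (T : R) : set (Kpow K n) :=
  [set x | C x /\ exists2 m, has_order x m & m%:R <= T].

End Torus.

(* Riemann's zeta function at a real argument s > 1. *)
Definition zeta (R : realType) (s : R) : R :=
  limn (series (fun k : nat => k.+1%:R `^ (- s))).

Definition error_term (R : realType) (d : nat) (T : R) : R :=
  if d == 1%N then T * ln T else T ^+ d.

(* Main.v *)
Require Import Defs.
From mathcomp Require Import all_boot all_order all_algebra.
From mathcomp Require Import finmap.
From mathcomp Require Import all_classical all_reals all_analysis.
From mathcomp Require Import ring lra zify.
From mathcomp Require Import separable cyclotomic.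
From mathcomp Require mpoly.
Import (canonicals, coercions) mpoly.

Set Implicit Arguments.
Unset Strict Implicit.
Unset Printing Implicit Defensive.

Import Order.TTheory GRing.Theory Num.Theory.
Import numFieldNormedType.Exports.
Local Open Scope classical_set_scope.
Local Open Scope ring_scope.

(** Let C = y G with y a torsion point of minimal order g in C.

    Geometry.  A linear torus G is the image of G_m^r under an injective
    monomial map ([linear_torus_param]): linear independence of characters
    shows that G is cut out by the characters trivial on it; since G is
    irreducible these form a saturated sublattice of Z^n, and the Smith normal
    form completes a basis of it to a basis of Z^n.  Moreover r is the Krull
    dimension d of C ([torus_coset_dim]).  Chains of length r are given by
    coordinate subtori.  A chain of length m yields m regular functions on
    G_m^r that are algebraically independent ([chain_independent]); counting
    monomials in these functions against Laurent monomials in r variables gives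
    m <= r ([chain_length_le]).

    Torsion points.  G is divisible, so the order of every torsion point of C
    is a multiple of g ([coset_exponent_dvd]), and if g | m with m invertible
    in K, then x^m = 1 has exactly m^d solutions in C
    ([coset_exponent_points]).  No order is divisible by the characteristic.
    Hence, if e k is the number of points of order g k in C, the sum of e j over
    the divisors j of k is (g k)^d for every k prime to the characteristic.

    Analysis.  With X = T / g and mu the Moebius function, inversion gives
      # C_T = g^d * sum over a <= X of mu(a) * (sum over b <= X / a of b^d),
    where a and b are prime to p.  The inner sum is
    (1 - 1/p) (X / a)^(d+1) / (d+1) up to 2 (X / a)^d, and the sum of
    mu(a) / a^(d+1) over a <= X is the inverse of zeta(d+1) (1 - p^-(d+1)) up to
    O(X^-d (1 + ln X)).  The second estimate needs no infinite series in mu: the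
    convolution of mu with the truncations of zeta is exactly 1
    ([mobius_inverts]), and only the tails of zeta have to be bounded.  The
    total error is O(X^d H_d + X H_1) with H_i the sum of a^-i over a <= X
    ([sieve_asymptotic]), which is O(T ln T) for d = 1 and O(T^d) for d >= 2,
    uniformly in p.

    Both characteristics are treated at once by taking p = 0 in characteristic
    zero: then p divides b only if b = 0, and the inverse of p is 0, so that the
    Euler factors at p disappear. *)

(** * Divisor sums and the Moebius function *)

Section Divisors.
Variable R : realType.

Lemma sum_multiples (a N : nat) (F : nat -> R) : (0 < a)%N ->
  \sum_(1 <= n < N.+1 | (a %| n)%N) F (n %/ a)%N =
  \sum_(1 <= b < (N %/ a).+1) F b.
Proof.
move=> a0; elim: N => [|N IH]; first by rewrite div0n !big_geq.
rewrite big_mkcond big_nat_recr //= -big_mkcond IH divnS //.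
case: (a %| N.+1)%N; last by rewrite addr0 add0n.
by rewrite add1n [RHS]big_nat_recr.
Qed.

Lemma sum_over_divisors (n N : nat) (F : nat -> R) : (0 < n <= N)%N ->
  \sum_(1 <= a < N.+1 | (a %| n)%N) F a =
  \sum_(1 <= a < n.+1 | (a %| n)%N) F a.
Proof.
case/andP=> n0 nN; rewrite (@big_cat_nat _ _ _ n.+1) //= [X in _ + X]big1_seq ?addr0 //.
move=> a /andP[an]; rewrite mem_index_iota => /andP[na _].
by move: (dvdn_leq n0 an); rewrite leqNgt na.
Qed.

(** Both sides are the sum of [F a b] over the pairs with [a * b <= N] and
    [w (a * b)]: on the left the pairs are ordered by [a], on the right by their
    product. *)
Lemma dirichlet_hyperbola (w : pred nat) (N : nat) (F : nat -> nat -> R) :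
    (forall a b, (0 < a)%N -> (0 < b)%N -> w (a * b)%N = w a && w b) ->
  \sum_(1 <= a < N.+1 | w a) \sum_(1 <= b < (N %/ a).+1 | w b) F a b =
  \sum_(1 <= n < N.+1 | w n)
     \sum_(1 <= a < N.+1 | (a %| n)%N) F a (n %/ a)%N.
Proof.
move=> wM.
transitivity (\sum_(1 <= a < N.+1) \sum_(1 <= n < N.+1)
   if (a %| n)%N && w n then F a (n %/ a)%N else 0).
  rewrite big_mkcond /=; apply: eq_big_nat => a /andP[a0 aN].
  rewrite [X in if _ then X else _]big_mkcond /=.
  rewrite -(@sum_multiples a N (fun b => if w b then F a b else 0)) //.
  rewrite [in LHS]big_mkcond /=.
  case wa: (w a); last first.
    rewrite big1_seq // => n /andP[_]; rewrite mem_index_iota => /andP[n0 _].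
    case: ifP => // /andP[/dvdnP[k nE]]; have k0 : (0 < k)%N by move: n0; rewrite nE; case: k {nE}.
    by rewrite nE mulnC wM // wa.
  apply: eq_big_nat => n /andP[n0 _]; case: ifP => //= /dvdnP[k nE].
  have k0 : (0 < k)%N by move: n0; rewrite nE; case: k {nE}.
  by rewrite nE mulnK // mulnC wM // wa.
rewrite exchange_big_nat /= [RHS]big_mkcond /=; apply: eq_bigr => n _.
case: (w n); last by rewrite big1 // => a _; rewrite andbF.
by rewrite [RHS]big_mkcond /=; apply: eq_bigr => a _; rewrite andbT.
Qed.

(** As [primes 0] is empty, the value at 0 is 1; only positive arguments matter. *)
Definition mobius (n : nat) : R :=
  \prod_(q <- primes n) (if logn q n == 1 then -1 else 0).

Lemma mobius_le1 n : `|mobius n| <= 1.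
Proof.
rewrite /mobius; elim/big_ind: _ => [|x y x1 y1|q _]; rewrite ?normr1 //.
  by rewrite normrM mulr_ile1.
by case: ifP; rewrite ?normrN ?normr1 ?normr0.
Qed.

Lemma mobius_prime_mul (q b : nat) : prime q -> (0 < b)%N ->
  mobius (q * b) = if (q %| b)%N then 0 else - mobius b.
Proof.
move=> pq b0; have q0 := prime_gt0 pq.
case: ifP => qb.
  rewrite /mobius (perm_big (q :: rem q (primes (q * b)))) /=; last first.
    by apply: perm_to_rem; rewrite mem_primes pq muln_gt0 q0 b0 dvdn_mulr.
  rewrite big_cons lognM // logn_prime // eqxx.
  have : (0 < logn q b)%N by rewrite logn_gt0 mem_primes pq b0 qb.
  by case: (logn q b) => // k _; rewrite mul0r.
rewrite /mobius (perm_big (q :: primes b)); last first.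
  apply: uniq_perm; rewrite ?primes_uniq //=.
    by rewrite primes_uniq mem_primes pq b0 qb.
  by move=> r; rewrite primesM // in_cons primes_prime // mem_seq1.
rewrite big_cons lognM // logn_prime // eqxx lognE qb pq b0 /= mulN1r; congr (- _).
apply: eq_big_seq => r; rewrite mem_primes => /and3P[pr _ rb].
rewrite lognM // logn_prime //.
by have -> : (r == q) = false by apply/eqP => rq; rewrite -rq rb in qb.
Qed.

(** For a prime [q] dividing [n], a divisor [b] prime to [q] is paired with
    [q * b], and the two terms cancel; the multiples of [q ^ 2] contribute 0. *)
Lemma sum_mobius (n N : nat) : (0 < n <= N)%N ->
  \sum_(1 <= a < N.+1 | (a %| n)%N) mobius a = (n == 1%N)%:R.
Proof.
case/andP=> n0 nN; case: (ltngtP n 1%N) => [|n1|nE].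
- by rewrite ltnNge n0.
- have pq := pdiv_prime n1; set q := pdiv n in pq.
  have qn : (q %| n)%N := pdiv_dvd n.
  rewrite (bigID (fun a => q %| a)%N) /=.
  apply/eqP; rewrite addr_eq0 -sumrN; apply/eqP.
  transitivity (\sum_(1 <= a < N.+1 | (q %| a)%N)
      if (q * (a %/ q) %| n)%N then mobius (q * (a %/ q)) else 0).
    rewrite -big_mkcondr /=; apply: eq_big => [a|a /andP[_ qa]].
      by rewrite andbC; case qa: (q %| a)%N => //=; rewrite mulnC divnK.
    by rewrite mulnC divnK.
  rewrite (sum_multiples _ (fun b => if (q * b %| n)%N then mobius (q * b) else 0))
    ?prime_gt0 //.
  rewrite [RHS](@big_cat_nat _ _ _ (N %/ q).+1) //=; last by rewrite ltnS leq_div.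
  rewrite [X in _ = _ + X]big1_seq ?addr0; last first.
    move=> a /andP[/andP[an qa]]; rewrite mem_index_iota => /andP[Nqa _].
    have : (q * a %| n)%N by rewrite Gauss_dvd ?qn ?an // prime_coprime.
    move/(dvdn_leq n0) => /leq_trans/(_ nN).
    by rewrite mulnC -leq_divRL ?prime_gt0 // leqNgt Nqa.
  rewrite [RHS]big_mkcond; apply: eq_big_nat => b /andP[b0 _].
  rewrite mobius_prime_mul //; case qb: (q %| b)%N => /=.
    by rewrite andbF if_same.
  rewrite andbT Gauss_dvd ?qn //.
  by rewrite prime_coprime // qb.
- rewrite nE (@sum_over_divisors 1 N) //; last by move: nN; rewrite nE.
  by rewrite big_mkcond big_nat1 /= /mobius big_nil.
Qed.

End Divisors.

(** * Power sums and the tails of the zeta series *)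

Section Estimates.
Variable R : realType.
Implicit Types (x y : R) (d m : nat).

Lemma subX_le d x y : 0 <= x <= y ->
  y ^+ d.+1 - x ^+ d.+1 <= d.+1%:R * y ^+ d * (y - x).
Proof.
case/andP=> x0 xy; have y0 := le_trans x0 xy.
rewrite subrXX mulrC ler_wpM2r ?subr_ge0 // mulr_natl -[d.+1 in X in _ <= X]card_ord.
rewrite -sumr_const ler_sum // => i _ /=.
rewrite -[in leRHS](subnK (_ : i <= d)%N) ?exprD; last by rewrite -ltnS.
by rewrite ler_wpM2l ?exprn_ge0 // lerXn2r ?nnegrE.
Qed.

Lemma subX_ge d x y : 0 <= x <= y ->
  d.+1%:R * x ^+ d * (y - x) <= y ^+ d.+1 - x ^+ d.+1.
Proof.
case/andP=> x0 xy; have y0 := le_trans x0 xy.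
rewrite subrXX [leRHS]mulrC ler_wpM2r ?subr_ge0 // mulr_natl -[d.+1 in X in X <= _]card_ord.
rewrite -sumr_const ler_sum // => i _ /=.
rewrite -[in leLHS](subnK (_ : i <= d)%N) ?exprD; last by rewrite -ltnS.
by rewrite ler_wpM2r ?exprn_ge0 // lerXn2r ?nnegrE.
Qed.

(** The sum is compared with the integral of [t ^+ d].  It is bounded in terms of
    a real [y] with integral part [m], because it will be used for [m = N %/ a]
    and [y = X / a]. *)
Lemma power_sum_approx d m y : m%:R <= y < m.+1%:R ->
  `|\sum_(1 <= b < m.+1) (b%:R : R) ^+ d - y ^+ d.+1 / d.+1%:R| <= y ^+ d.
Proof.
case/andP=> my ym; have d0 : (0 : R) < d.+1%:R by [].
have y0 : 0 <= y := le_trans (ler0n _ _) my.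
have lo : (m%:R : R) ^+ d.+1 <= d.+1%:R * \sum_(1 <= b < m.+1) (b%:R : R) ^+ d.
  elim: (m) => [|k IH]; first by rewrite big_geq // mulr0 expr0n.
  rewrite big_nat_recr //= mulrDr.
  have := @subX_le d k%:R k.+1%:R; rewrite ler0n ler_nat leqnSn => /(_ isT).
  rewrite -[k.+1 in X in _ * X]addn1 natrD [_ + 1 - _]addrAC subrr add0r mulr1.
  by move: IH; lra.
have hi : d.+1%:R * \sum_(1 <= b < m.+1) (b%:R : R) ^+ d
          <= (m%:R : R) ^+ d.+1 + d.+1%:R * y ^+ d.
  case: (m) my => [|k] ky.
    by rewrite big_geq // mulr0 addr_ge0 ?exprn_ge0 ?mulr_ge0 ?exprn_ge0.
  rewrite big_nat_recr //= mulrDr lerD //; last first.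
    by rewrite ler_wpM2l // lerXn2r ?nnegrE.
  elim: (k) => [|j IH]; first by rewrite big_geq // mulr0 exprn_ge0.
  rewrite big_nat_recr //= mulrDr.
  have := @subX_ge d j.+1%:R j.+2%:R; rewrite ler0n ler_nat leqnSn => /(_ isT).
  rewrite -[j.+2 in X in _ * X]addn1 natrD [_ + 1 - _]addrAC subrr add0r mulr1.
  by move: IH; lra.
have my1 : m%:R ^+ d.+1 <= y ^+ d.+1 by rewrite lerXn2r ?nnegrE.
have ym1 : y ^+ d.+1 - m%:R ^+ d.+1 <= d.+1%:R * y ^+ d.
  have := @subX_le d m%:R y; rewrite ler0n my => /(_ isT) /le_trans; apply.
  rewrite ler_piMr ?mulr_ge0 ?exprn_ge0 //.
  by move: ym; rewrite -addn1 natrD; lra.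
rewrite -(ler_pM2l d0) -{1}(gtr0_norm d0) -normrM mulrBr.
rewrite [_ * (_ / _)]mulrC divfK ?gt_eqF // ler_norml; apply/andP; split; lra.
Qed.

(** This makes the tail of the zeta series at [d.+1] telescope. *)
Lemma inv_powS_le d m : (0 < d)%N -> (0 < m)%N ->
  (m.+1%:R ^+ d.+1)^-1 <= (m%:R ^+ d)^-1 - (m.+1%:R ^+ d)^-1 :> R.
Proof.
case: d => // d _ m0; set u : R := m%:R; set v : R := m.+1%:R.
have u0 : 0 < u by rewrite ltr0n.
have vE : v = u + 1 by rewrite /v -addn1 natrD.
have v0 : 0 < v by lra.
have U0 : 0 < u ^+ d.+1 by rewrite exprn_gt0.
have V0 : 0 < v ^+ d.+1 by rewrite exprn_gt0.
have H : u ^+ d.+1 + u ^+ d.+1 / u <= v ^+ d.+1.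
  have := @subX_ge d u v; rewrite vE (ltW u0) lerDl ler01 => /(_ isT).
  rewrite [u + 1 - u]addrAC subrr add0r mulr1 -vE => H.
  have -> : u ^+ d.+1 / u = u ^+ d by rewrite exprS [u * _]mulrC mulfK ?gt_eqF.
  have : 0 <= u ^+ d by rewrite exprn_ge0 // ltW.
  move: H.
  rewrite -natr1; have : (0:R) <= d%:R by [].
  nra.
rewrite [v ^+ d.+2]exprS invfM.
have -> : (u ^+ d.+1)^-1 - (v ^+ d.+1)^-1 = (v ^+ d.+1)^-1 * ((v ^+ d.+1 - u ^+ d.+1) / u ^+ d.+1).
  by field; rewrite !gt_eqF.
rewrite mulrC ler_pM2l ?invr_gt0 // ler_pdivlMr //.
apply: (@le_trans _ _ (u ^+ d.+1 / u)); last by lra.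
rewrite mulrC ler_pM2l // lef_pV2 ?posrE //; lra.
Qed.

Definition zeta_psum (d m : nat) : R := \sum_(1 <= b < m.+1) ((b%:R : R) ^+ d.+1)^-1.

Lemma zeta_psum_nd d : {homo zeta_psum d : m k / (m <= k)%N >-> m <= k}.
Proof.
move=> m k mk; rewrite /zeta_psum [leRHS](@big_cat_nat _ _ _ m.+1) //=.
by rewrite lerDl sumr_ge0 // => i _; rewrite invr_ge0 exprn_ge0.
Qed.

Lemma zeta_psum_tail d m k : (0 < d)%N -> (0 < m)%N -> (m <= k)%N ->
  zeta_psum d k - zeta_psum d m <= (m%:R ^+ d)^-1.
Proof.
move=> d0 m0 mk; apply: (@le_trans _ _ ((m%:R ^+ d)^-1 - (k%:R ^+ d)^-1)); last first.
  by rewrite gerBl invr_ge0 exprn_ge0.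
elim: k mk => [|k IH]; first by rewrite leqn0 => /eqP ->; rewrite !subrr.
rewrite leq_eqVlt => /orP[/eqP <-|]; first by rewrite !subrr.
rewrite ltnS => mk; have k0 := leq_trans m0 mk.
have := inv_powS_le d0 k0; have := IH mk; rewrite {3}/zeta_psum big_nat_recr //= -/(zeta_psum d k).
by lra.
Qed.

Lemma zetaE d : zeta (d.+1%:R : R) = limn (zeta_psum d).
Proof.
rewrite /zeta; congr (limn _); apply/funext => m.
rewrite /series /zeta_psum /= big_add1 /=; apply: eq_bigr => k _.
by rewrite powRN powR_mulrn.
Qed.

(** The telescoping bound is [m ^- d], and [y < m.+1 <= 2 * m].  For [m = 0] the
    bound holds because zeta is at most 2 and [y < 1]. *)
Lemma zeta_tail d m y : (0 < d)%N -> 0 < y -> m%:R <= y < m.+1%:R ->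
  zeta_psum d m <= zeta (d.+1%:R : R) <= zeta_psum d m + 2 ^+ d / y ^+ d.
Proof.
move=> d0 y0 /andP[my ym].
have cv : cvgn (zeta_psum d).
  apply: nondecreasing_is_cvgn; first exact: zeta_psum_nd.
  exists (zeta_psum d 1 + 1) => _ [k _ <-].
  apply: le_trans (zeta_psum_nd _ (leq_addr 1 k)) _; rewrite -lerBlDl.
  by apply: le_trans (zeta_psum_tail d0 _ (leq_addl k 1)) _; rewrite // expr1n invr1.
rewrite zetaE nondecreasing_cvgn_le //=; last exact: zeta_psum_nd.
apply: limr_le => //; exists m => // k /= mk.
have Y0 : 0 < y ^+ d by rewrite exprn_gt0.
case: (posnP m) => m0; last first.
  rewrite -lerBlDl; apply: le_trans (zeta_psum_tail d0 m0 mk) _.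
  have M0 : (0 : R) < m%:R ^+ d by rewrite exprn_gt0 // ltr0n.
  rewrite ler_pdivlMr // mulrC ler_pdivrMr // -exprMn lerXn2r ?nnegrE ?mulr_ge0 ?(ltW y0) //.
  by move: ym m0; rewrite -(ler_nat R) -natr1; lra.
rewrite m0 [zeta_psum d 0]big_geq // add0r.
have y1 : y <= 1 by move: ym; rewrite m0 => /ltW.
apply: (@le_trans _ _ 2).
  apply: le_trans (zeta_psum_nd _ (leq_addr 1 k)) _.
  have -> : 2 = zeta_psum d 1 + 1 :> R by rewrite /zeta_psum big_nat1 expr1n invr1.
  rewrite -lerBlDl.
  by apply: le_trans (zeta_psum_tail d0 _ (leq_addl k 1)) _; rewrite // expr1n invr1.
rewrite ler_pdivlMr //; apply: (@le_trans _ _ (2 ^+ d * 1)); last first.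
  by rewrite mulr1.
have yd1 : y ^+ d <= 1 by rewrite exprn_ile1 // ltW.
rewrite ler_pM // ?(ltW Y0) //.
by case: (d) d0 => // j _; rewrite exprS ler_peMr // exprn_ege1 // ler1n.
Qed.

(** The increments compare: [ln (1 - 1 / m.+1) <= - (1 / m.+1)]. *)
Lemma harmonic_le m : (0 < m)%N ->
  \sum_(1 <= a < m.+1) (a%:R : R)^-1 <= 1 + ln (m%:R : R).
Proof.
elim: m => // -[|m] IH _; first by rewrite big_nat1 ln1 invr1 addr0.
rewrite big_nat_recr //=; have /= IH' := IH isT.
set u : R := m.+1%:R in IH' *; set v : R := m.+2%:R.
have u0 : 0 < u by rewrite ltr0n.
have vE : v = u + 1 by rewrite /v -addn1 natrD.
have v0 : 0 < v by lra.
have := @le_ln1Dx R (- v^-1).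
have -> : 1 + - v^-1 = u / v by rewrite vE; field; lra.
rewrite ln_div ?posrE //.
have v1 : v^-1 < 1 by rewrite invf_lt1 // vE; lra.
rewrite ltrN2 => /(_ v1) HH; apply: le_trans (lerD IH' (lexx _)) _.
move: HH; move: (v^-1) (ln u) (ln v) => w a b. lra.
Qed.

Lemma inv_powers_le d m : (1 < d)%N ->
  \sum_(1 <= a < m.+1) ((a%:R : R) ^+ d)^-1 <= 2.
Proof.
case: d => [//|[//|d]] _; rewrite -/(zeta_psum d.+1 m).
apply: le_trans (zeta_psum_nd _ (leq_addr 1 m)) _.
have -> : 2 = zeta_psum d.+1 1 + 1 :> R by rewrite /zeta_psum big_nat1 expr1n invr1.
rewrite -lerBlDl.
by apply: le_trans (zeta_psum_tail _ _ (leq_addl m 1)) _; rewrite // expr1n invr1.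
Qed.

End Estimates.

(** * Sums over integers prime to the characteristic *)

Section Sieve.
Variables (R : realType) (p : nat).
Hypothesis pP : p = 0%N \/ prime p.
Implicit Types (d m N : nat) (X y : R).

Lemma dvdn_mulP a b : (p %| a * b)%N = (p %| a)%N || (p %| b)%N.
Proof. by case: pP => [->|/Euclid_dvdM //]; rewrite !dvd0n muln_eq0. Qed.

Lemma inv_charn_le : 0 <= (p%:R : R)^-1 <= 2^-1.
Proof.
rewrite invr_ge0 ler0n /=; case: pP => [->|/prime_gt1 p1]; first by rewrite invr0 invr_ge0.
by rewrite lef_pV2 ?posrE ?ltr0n ?ler_nat // ltnW.
Qed.

Lemma inv_charnX_le d : (0 < d)%N -> 0 <= ((p%:R : R) ^+ d)^-1 <= 2^-1.
Proof.
case: d => // d _; case/andP: inv_charn_le => p0 p1.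
rewrite -exprVn exprn_ge0 //= exprS.
apply: (le_trans _ p1); rewrite ler_piMr // exprn_ile1 //.
by apply: le_trans p1 _; rewrite invf_le1 ?ler1n.
Qed.

(** The multiples of [p] are removed.  For [p = 0] nothing is removed: the last sum
    is empty, as [m %/ 0 = 0]. *)
Lemma sum_sieve m (F : nat -> R) :
  \sum_(1 <= b < m.+1 | ~~ (p %| b)%N) F b =
  \sum_(1 <= b < m.+1) F b - \sum_(1 <= b < (m %/ p).+1) F (p * b)%N.
Proof.
rewrite [X in _ = X - _](bigID (fun b => p %| b)%N) /=.
suff -> : \sum_(1 <= b < m.+1 | (p %| b)%N) F b =
          \sum_(1 <= b < (m %/ p).+1) F (p * b)%N by rewrite addrAC subrr add0r.
case: (posnP p) => [-> | p0].
  rewrite divn0 [RHS]big_geq // big1_seq // => b.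
  by rewrite dvd0n mem_index_iota => /andP[/eqP ->].
rewrite -sum_multiples //; apply: eq_bigr => b pb.
by rewrite mulnC divnK.
Qed.

Lemma div_between m y a : (0 < a)%N -> m%:R <= y < m.+1%:R ->
  (m %/ a)%:R <= y / a%:R < (m %/ a).+1%:R.
Proof.
move=> a0 /andP[my ym]; have A0 : (0 : R) < a%:R by rewrite ltr0n.
rewrite ler_pdivlMr // ltr_pdivrMr // -!natrM; apply/andP; split.
  by apply: le_trans my; rewrite ler_nat leq_trunc_div.
by apply: lt_le_trans ym _; rewrite ler_nat ltn_ceil.
Qed.

(** The multiples of [p] contribute [p ^ d] times a power sum up to [y / p], whose
    error is at most [p ^ d * (y / p) ^ d]: this is why the bound is uniform in
    [p]. *)
Lemma coprime_power_sum d m y : m%:R <= y < m.+1%:R ->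
  `|\sum_(1 <= b < m.+1 | ~~ (p %| b)%N) (b%:R : R) ^+ d
    - y ^+ d.+1 / d.+1%:R * (1 - p%:R^-1)| <= 2 * y ^+ d.
Proof.
move=> my; have := power_sum_approx d my; rewrite sum_sieve.
have y0 : 0 <= y by case/andP: my => /(le_trans (ler0n _ _)).
have yd0 : 0 <= y ^+ d by rewrite exprn_ge0.
case: (posnP p) => [-> | p0].
  by rewrite divn0 [X in _ - X - _]big_geq // invr0 !subr0 mulr1; lra.
have := power_sum_approx d (div_between p0 my).
under [X in _ -> _ -> `|_ - X - _| <= _]eq_bigr do rewrite natrM exprMn.
rewrite -mulr_sumr; set S := \sum_(1 <= b < _) _; set S' := \sum_(1 <= b < _) _.
have P0 : (0 : R) < p%:R by rewrite ltr0n.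
have PD : (0 : R) < p%:R ^+ d by rewrite exprn_gt0.
rewrite -(ler_pM2l PD) -{1}(gtr0_norm PD) -normrM mulrBr !expr_div_n.
rewrite [_ * (y ^+ d / _)]mulrC divfK ?gt_eqF // => H1 H2.
have E : p%:R ^+ d * (y ^+ d.+1 / p%:R ^+ d.+1 / d.+1%:R)
         = y ^+ d.+1 / d.+1%:R * p%:R^-1 :> R.
  by rewrite [p%:R ^+ d.+1]exprS; field; rewrite !gt_eqF.
rewrite E in H1; move: H1 H2; rewrite mulrBr mulr1.
move: (p%:R ^+ d * S) (y ^+ d.+1 / d.+1%:R * p%:R^-1) (y ^+ d.+1 / d.+1%:R) (y ^+ d) => a b c e.
by rewrite !ler_norml; lra.
Qed.

Lemma zeta_ge1 d : (0 < d)%N -> 1 <= zeta (d.+1%:R : R).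
Proof.
move=> d0; have := @zeta_tail R d 1 1 d0 ltr01; rewrite !mulr1n lexx ltr1n => /(_ isT).
by rewrite /zeta_psum big_nat1 !expr1n invr1 => /andP[].
Qed.

(** The zeta function at [d.+1] without its Euler factor at [p]. *)
Definition zeta_coprime d : R := zeta (d.+1%:R : R) * (1 - (p%:R ^+ d.+1)^-1).

Lemma zeta_coprime_ge d : (0 < d)%N -> 2^-1 <= zeta_coprime d.
Proof.
move=> d0; have z1 := zeta_ge1 d0; have := inv_charnX_le (ltn0Sn d).
rewrite /zeta_coprime; move: (_^-1) (zeta _) z1 => q z z1 /andP[q0 q1]; nra.
Qed.

Lemma coprime_zeta_tail d m y : (0 < d)%N -> 0 < y -> m%:R <= y < m.+1%:R ->
  `|\sum_(1 <= b < m.+1 | ~~ (p %| b)%N) ((b%:R : R) ^+ d.+1)^-1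
    - zeta_coprime d| <= 2 ^+ d.+1 / y ^+ d.
Proof.
move=> d0 y0 my; have := zeta_tail d0 y0 my; rewrite sum_sieve -/(zeta_psum R d m).
have yd0 : 0 < y ^+ d by rewrite exprn_gt0.
have C0 : 0 < 2 ^+ d / y ^+ d by rewrite divr_gt0 // exprn_gt0.
rewrite /zeta_coprime [2 ^+ d.+1]exprS -mulrA.
case: (posnP p) => [-> | p0].
  move: (2 ^+ d / y ^+ d) C0 => C C0.
  rewrite divn0 [X in _ -> `|_ - X - _| <= _]big_geq // expr0n invr0 !subr0 mulr1.
  by rewrite ler_norml; lra.
have P0 : (0 : R) < p%:R by rewrite ltr0n.
have PD : (0 : R) < p%:R ^+ d by rewrite exprn_gt0.
have := zeta_tail d0 (divr_gt0 y0 P0) (div_between p0 my).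
under [X in _ -> _ -> `|_ - X - _| <= _]eq_bigr do rewrite natrM exprMn invfM.
rewrite -mulr_sumr -/(zeta_psum R d (m %/ p)).
have -> : 2 ^+ d / (y / p%:R) ^+ d = 2 ^+ d / y ^+ d * p%:R ^+ d :> R.
  by rewrite expr_div_n; field; rewrite !gt_eqF.
have q0 : 0 < (p%:R ^+ d.+1)^-1 :> R by rewrite invr_gt0 exprn_gt0.
have qp : p%:R ^+ d * (p%:R ^+ d.+1)^-1 <= 1 :> R.
  by rewrite ler_pdivrMr ?exprn_gt0 // mul1r exprS ler_peMl ?(ltW PD) // ler1n.
move: (2 ^+ d / y ^+ d) (zeta_psum _ _ m) (zeta_psum _ _ _) (zeta _) (p%:R ^+ d) (p%:R ^- d.+1) C0 q0 qp PD.
move=> C s s' z u q C0 q0 qp u0 /andP[H1 H2] /andP[H3 H4].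
have H5 : q * (z - s') <= C.
  apply: (@le_trans _ _ (q * (C * u))); first by rewrite ler_pM2l //; lra.
  by rewrite mulrCA mulrA -[leRHS]mulr1 -mulrA ler_pM2l // mulrC.
have H6 : 0 <= q * (z - s') by apply: mulr_ge0; rewrite ?subr_ge0 // ltW.
by rewrite ler_norml; lra.
Qed.

Lemma coprimeM a b : (0 < a)%N -> (0 < b)%N ->
  ~~ (p %| a * b)%N = ~~ (p %| a)%N && ~~ (p %| b)%N.
Proof. by rewrite dvdn_mulP negb_or. Qed.

Lemma char_ndvd1 : ~~ (p %| 1)%N.
Proof. by rewrite dvdn1; case: pP => [->//|/prime_gt1]; case: p => [|[]]. Qed.

Local Notation mu := (@mobius R).

(** For [h n = n ^- d.+1] this is a finite form of the fact that the Dirichlet series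
    of the Moebius function over the integers prime to [p] is the inverse of
    [zeta_coprime d]. *)
Lemma mobius_inverts N (h : nat -> R) : (0 < N)%N ->
  \sum_(1 <= a < N.+1 | ~~ (p %| a)%N)
     mu a * \sum_(1 <= b < (N %/ a).+1 | ~~ (p %| b)%N) h (a * b)%N = h 1%N.
Proof.
move=> N0; under eq_bigr do rewrite mulr_sumr.
rewrite (dirichlet_hyperbola N (fun a b => mu a * h (a * b)%N) coprimeM).
transitivity (\sum_(1 <= n < N.+1 | ~~ (p %| n)%N) (n == 1%N)%:R * h n).
  rewrite big_nat_cond [RHS]big_nat_cond; apply: eq_bigr => n /andP[nN _].
  rewrite -(@sum_mobius R n N) // mulr_suml; apply: eq_bigr => a an.
  by rewrite mulnC divnK.
rewrite big_mkcond big_nat_recl //= char_ndvd1 mul1r big1_seq ?addr0 // => n.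
rewrite mem_index_iota => /andP[_ /andP[+ _]]; case: n => // n _.
by case: ifP => // _; rewrite mul0r.
Qed.

(** By hypothesis, the right-hand side is the sum of [mu a * e j] over the [a] and
    [j] whose product divides some [n]; for fixed [n] and [j], summation over [a]
    leaves only [j = n]. *)
Lemma mobius_inversion N (e f : nat -> R) :
    (forall k, (0 < k <= N)%N -> ~~ (p %| k)%N ->
       \sum_(1 <= j < N.+1 | (j %| k)%N) e j = f k) ->
  \sum_(1 <= k < N.+1 | ~~ (p %| k)%N) e k =
  \sum_(1 <= a < N.+1 | ~~ (p %| a)%N)
     mu a * \sum_(1 <= b < (N %/ a).+1 | ~~ (p %| b)%N) f b.
Proof.
move=> ef; under [RHS]eq_bigr do rewrite mulr_sumr.
rewrite (dirichlet_hyperbola N (fun a b => mu a * f b) coprimeM).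
rewrite big_nat_cond [RHS]big_nat_cond; apply: eq_bigr => n /andP[/andP[n0 nN] pn].
(* Both sides say that [a * j] divides [n]. *)
have swap a j : (0 < a)%N -> (0 < j)%N ->
    (a %| n)%N && (j %| n %/ a)%N = (j %| n)%N && (a %| n %/ j)%N.
  move=> a0 j0; apply/andP/andP => -[H1 H2].
    have H : (j * a %| n)%N by rewrite -dvdn_divRL.
    by rewrite (dvdn_trans (dvdn_mulr a (dvdnn j)) H) dvdn_divRL
               ?(dvdn_trans (dvdn_mulr a (dvdnn j)) H) // mulnC.
  have H : (a * j %| n)%N by rewrite -dvdn_divRL.
  by rewrite (dvdn_trans (dvdn_mulr j (dvdnn a)) H) dvdn_divRL
             ?(dvdn_trans (dvdn_mulr j (dvdnn a)) H) // mulnC.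
have quo a : (0 < a)%N -> (a %| n)%N -> (0 < n %/ a <= N)%N.
  move=> a0 an; rewrite divn_gt0 // (dvdn_leq _ an) //=.
  by rewrite (leq_trans (leq_div _ _)).
transitivity (\sum_(1 <= a < N.+1) \sum_(1 <= j < N.+1)
   if (j %| n)%N && (a %| n %/ j)%N then mu a * e j else 0); last first.
  rewrite [RHS]big_mkcond; apply: eq_big_nat => a /andP[a0 _]; case: ifP => an.
    have /andP[q0 qN] := quo _ a0 an.
    rewrite -ef ?q0 //; last by apply: contra pn => H; rewrite -(divnK an) dvdn_mulr.
    rewrite mulr_sumr [RHS]big_mkcond; apply: eq_big_nat => j /andP[j0 _].
    by rewrite -swap // an.
  rewrite big1_seq // => j; rewrite mem_index_iota => /andP[_ /andP[j0 _]].
  by rewrite -swap // an.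
rewrite exchange_big_nat /= (bigD1_seq n) ?iota_uniq ?mem_index_iota ?n0 //=.
rewrite [X in _ + X]big1_seq ?addr0; last first.
  move=> j; rewrite mem_index_iota => /andP[jn /andP[j0 _]].
  case jdn: (j %| n)%N; last by rewrite big1.
  rewrite /= -big_mkcond -mulr_suml sum_mobius ?quo //.
  rewrite (_ : (_ == 1)%N = false) ?mul0r //; apply/eqP => nj.
  by move: jn; rewrite -(divnK jdn) nj mul1n eqxx.
rewrite dvdnn /= -big_mkcond -mulr_suml sum_mobius; last by rewrite quo.
by rewrite divnn n0 mul1r.
Qed.

Lemma mobius_sum_le N (F B : nat -> R) :
    (forall a, (0 < a <= N)%N -> `|F a| <= B a) ->
  `|\sum_(1 <= a < N.+1 | ~~ (p %| a)%N) mu a * F a| <= \sum_(1 <= a < N.+1) B a.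
Proof.
move=> FB; rewrite big_mkcond; apply: le_trans (ler_norm_sum _ _ _) _.
rewrite big_nat_cond [leRHS]big_nat_cond; apply: ler_sum => a /andP[aN _].
have FBa := FB a aN; case: ifP => _; last by rewrite normr0 (le_trans _ FBa).
by rewrite normrM (le_trans _ FBa) // ler_piMl // mobius_le1.
Qed.

(** Moebius inversion expresses the sum of [e] by the sums [S a] of [d]-th powers
    up to [N %/ a].  Replacing [S a] by its main term [c * (X / a) ^ d.+1] costs the
    first error term and leaves the factor [M], the sum of [mu a / a ^ d.+1].
    Replacing the truncated zeta sums [Z a] by their limit in [mobius_inverts]
    shows that [M] is the inverse of [zeta_coprime d] up to the second error
    term. *)
Lemma sieve_asymptotic d N X (G : R) (e : nat -> R) :
    (0 < d)%N -> (0 < N)%N -> N%:R <= X < N.+1%:R -> 0 <= G ->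
    (forall k, (0 < k <= N)%N -> ~~ (p %| k)%N ->
       \sum_(1 <= j < N.+1 | (j %| k)%N) e j = G * k%:R ^+ d) ->
  `|\sum_(1 <= k < N.+1 | ~~ (p %| k)%N) e k
    - G * (X ^+ d.+1 * ((1 - p%:R^-1) / d.+1%:R / zeta_coprime d))|
  <= G * (2 * X ^+ d * \sum_(1 <= a < N.+1) ((a%:R : R) ^+ d)^-1
          + 2 ^+ d.+2 * X * \sum_(1 <= a < N.+1) (a%:R : R)^-1).
Proof.
move=> d0 N0 NX G0 eG; have X0 : 0 < X.
  by case/andP: NX => + _; apply: lt_le_trans; rewrite ltr0n.
rewrite (mobius_inversion eG) /=.
pose S a : R := \sum_(1 <= b < (N %/ a).+1 | ~~ (p %| b)%N) (b%:R : R) ^+ d.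
pose Z a : R := \sum_(1 <= b < (N %/ a).+1 | ~~ (p %| b)%N) ((b%:R : R) ^+ d.+1)^-1.
pose M : R := \sum_(1 <= a < N.+1 | ~~ (p %| a)%N) mu a * (a%:R ^+ d.+1)^-1.
pose c : R := (1 - p%:R^-1) / d.+1%:R.
have c01 : 0 <= c <= 1.
  rewrite /c; have /andP[] := inv_charn_le; move: (_^-1) => q q0 q1.
  by rewrite ler_pdivlMr // ler_pdivrMr // mul0r mul1r -natr1; have := ler0n R d; lra.
have -> : \sum_(1 <= a < N.+1 | ~~ (p %| a)%N)
     mu a * \sum_(1 <= b < (N %/ a).+1 | ~~ (p %| b)%N) (G * b%:R ^+ d) =
   G * \sum_(1 <= a < N.+1 | ~~ (p %| a)%N) mu a * S a.
  by rewrite mulr_sumr; apply: eq_bigr => a _; rewrite -mulr_sumr mulrCA.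
rewrite -mulrBr normrM [X in X * _]ger0_norm //; apply: ler_wpM2l => //.
have HS : `|\sum_(1 <= a < N.+1 | ~~ (p %| a)%N) mu a * S a - X ^+ d.+1 * c * M|
    <= 2 * X ^+ d * \sum_(1 <= a < N.+1) ((a%:R : R) ^+ d)^-1.
  rewrite [_ * M]mulr_sumr -sumrB [leRHS]mulr_sumr.
  under eq_bigr do rewrite mulrCA -mulrBr.
  apply: mobius_sum_le => a /andP[a0 aN].
  have := coprime_power_sum d (div_between a0 NX); rewrite !expr_div_n -/(S a) mulrA.
  apply: le_trans; rewrite le_eqVlt; apply/orP; left; apply/eqP; congr (`|_ - _|).
  by rewrite /c; ring.
have HZ : `|1 - M * zeta_coprime d| <=
    2 ^+ d.+1 / X ^+ d * \sum_(1 <= a < N.+1) (a%:R : R)^-1.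
  have E := @mobius_inverts N (fun n => (n%:R ^+ d.+1)^-1) N0.
  rewrite -[X in `|X - _|]invr1 -[X in `|X^-1 - _|](expr1n _ d.+1) -E.
  rewrite [M * _]mulr_suml -sumrB [leRHS]mulr_sumr.
  rewrite (eq_bigr (fun a => mu a * ((a%:R ^+ d.+1)^-1 * (Z a - zeta_coprime d)))).
    apply: mobius_sum_le => a /andP[a0 aN].
    have A0 : (0 : R) < a%:R by rewrite ltr0n.
    have := coprime_zeta_tail d0 (divr_gt0 X0 A0) (div_between a0 NX).
    rewrite -/(Z a) normrM ger0_norm ?invr_ge0 ?exprn_ge0 // => H.
    apply: le_trans (ler_wpM2l _ H) _; first by rewrite invr_ge0 exprn_ge0.
    rewrite expr_div_n [a%:R ^+ d.+1]exprS le_eqVlt; apply/orP; left; apply/eqP.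
    by field; rewrite !gt_eqF // exprn_gt0.
  move=> a _; rewrite -mulrA -mulrBr; congr (_ * _); rewrite mulrBr /Z mulr_sumr.
  by congr (_ - _); apply: eq_bigr => b _; rewrite natrM exprMn invfM.
have z0 := zeta_coprime_ge d0.
set z := zeta_coprime d in z0 HZ *.
set H1 := \sum_(1 <= a < N.+1) (a%:R)^-1 in HZ *.
rewrite -/c.
have zp : 0 < z by apply: lt_le_trans z0; rewrite invr_gt0.
have HM : `|X ^+ d.+1 * c * M - X ^+ d.+1 * (c / z)| <= 2 ^+ d.+2 * X * H1.
  have -> : X ^+ d.+1 * c * M - X ^+ d.+1 * (c / z) = - (X ^+ d.+1 * (c / z) * (1 - M * z)).
    by field; rewrite gt_eqF.
  have /andP[cz0 cz2] : 0 <= c / z <= 2.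
    rewrite divr_ge0 ?(ltW zp) //=; last by lra.
    by rewrite ler_pdivrMr //; lra.
  rewrite normrN normrM ger0_norm; last first.
    by apply: mulr_ge0 => //; rewrite exprn_ge0 ?(ltW X0).
  apply: (@le_trans _ _ (X ^+ d.+1 * 2 * (2 ^+ d.+1 / X ^+ d * H1))).
    apply: ler_pM => //; first by apply: mulr_ge0 => //; rewrite exprn_ge0 ?(ltW X0).
    by apply: ler_wpM2l; rewrite ?exprn_ge0 ?(ltW X0).
  rewrite [X ^+ d.+1]exprS [2 ^+ d.+2]exprS le_eqVlt; apply/orP; left; apply/eqP.
  by field; rewrite gt_eqF // exprn_gt0.
by have := ler_normD (\sum_(1 <= a < N.+1 | ~~ (p %| a)%N) mu a * S a - X ^+ d.+1 * c * M)
  (X ^+ d.+1 * c * M - X ^+ d.+1 * (c / z)); rewrite addrA subrK; lra.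
Qed.

End Sieve.

Section Asymptotics.
Variable R : realType.

(** The inverse of (d + 1) zeta(d + 1) g, corrected by the Euler factors at [p] of
    zeta(1) and zeta(d + 1). *)
Definition density (p d g : nat) : R :=
  (1 - p%:R^-1) / (d.+1%:R * zeta d.+1%:R * (1 - (p%:R ^+ d.+1)^-1) * g%:R).

(** The constants are chosen before [p], [e] and [T]: this is the source of the
    uniformity in the field and in the coset. *)
Lemma sieve_error_term (d g : nat) : (0 < d)%N -> (0 < g)%N ->
  exists M T0 : R, forall p (e : nat -> R) (T : R) (N : nat), p = 0%N \/ prime p ->
      T0 <= T -> N%:R <= T / g%:R < N.+1%:R ->
    (forall k, (0 < k <= N)%N -> ~~ (p %| k)%N ->
       \sum_(1 <= j < N.+1 | (j %| k)%N) e j = (g * k)%:R ^+ d) ->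
    `|\sum_(1 <= k < N.+1 | ~~ (p %| k)%N) e k - T ^+ d.+1 * density p d g|
      <= M * error_term d T.
Proof.
move=> d0 g0; have G0 : (0 : R) < g%:R by rewrite ltr0n.
(* [T0] ensures [1 <= T / g] and [1 <= ln T].  Up to [g ^ d], the error is then at
   most [(2 * 2 + 2 ^ 3 * 2) * T * ln T] for [d = 1], and at most
   [(2 * 2 + 2 ^ (d + 2)) * T ^ d] for [d >= 2]. *)
exists (g%:R ^+ d * (20 + 2 ^+ d.+2)), (g%:R + expR 1) => p e T N pP T0 NX eG.
have T1 : 1 <= ln T.
  rewrite -(expRK 1) ler_ln ?posrE ?expR_gt0 //; first by lra.
  by have := expR_gt0 (1 : R); lra.
have Tg : g%:R <= T by have := expR_gt0 (1 : R); lra.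
have Tpos : 0 < T by lra.
have T1' : 1 <= T by apply: le_trans Tg; rewrite ler1n.
set X := T / g%:R in NX *.
have X1 : 1 <= X by rewrite ler_pdivlMr // mul1r.
have X0 : 0 < X by lra.
have XT : X <= T by rewrite ler_pdivrMr // ler_peMr ?(ltW Tpos) // ler1n.
have N0 : (0 < N)%N.
  case: (posnP N) NX => // -> /andP[_].
  by rewrite ltNge X1.
have N0' : (0 : R) < N%:R by rewrite ltr0n.
have NleX : N%:R <= X by case/andP: NX.
have := sieve_asymptotic pP d0 N0 NX (exprn_ge0 d (ltW G0)) (e := e).
have {}eG k : (0 < k <= N)%N -> ~~ (p %| k)%N ->
    \sum_(1 <= j < N.+1 | (j %| k)%N) e j = g%:R ^+ d * k%:R ^+ d.
  by move=> k0 pk; rewrite eG // natrM exprMn.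
move=> /(_ eG); have -> : g%:R ^+ d * (X ^+ d.+1 * ((1 - p%:R^-1) / d.+1%:R / zeta_coprime R p d))
   = T ^+ d.+1 * density p d g.
  rewrite /density /zeta_coprime !invfM expr_div_n [g%:R ^+ d.+1]exprS invfM.
  move: (1 - p%:R^-1) ((zeta _)^-1) ((1 - _)^-1) ((d.+1%:R)^-1) => a b c u.
  by field; rewrite !gt_eqF // exprn_gt0.
clearbody X.
move=> /le_trans; apply; rewrite -[leRHS]mulrA ler_pM2l ?exprn_gt0 //.
have H1N := @harmonic_le R N N0.
have lnN : ln (N%:R : R) <= ln T.
  by rewrite ler_ln ?posrE // (le_trans NleX).
have H1T := le_trans H1N (lerD (lexx 1) lnN).
have Xd : X ^+ d <= T ^+ d by rewrite lerXn2r ?nnegrE ?(ltW X0) ?(ltW Tpos).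
have C0 : (0 : R) < 2 ^+ d.+2 by rewrite exprn_gt0.
have H1ge : 0 <= \sum_(1 <= a < N.+1) (a%:R : R)^-1.
  by apply: sumr_ge0 => a _; rewrite invr_ge0.
rewrite /error_term; case: eqP => [dE|/eqP d1].
  have -> : \sum_(1 <= a < N.+1) ((a%:R : R) ^+ d)^-1 = \sum_(1 <= a < N.+1) (a%:R : R)^-1.
    by rewrite dE.
  move: H1T H1ge; move: (\sum_(_ <= _ < _) _) => H H1T H1ge; rewrite dE expr1.
  have HT : X * H <= T * (2 * ln T) by apply: ler_pM; rewrite ?(ltW X0) //; lra.
  have -> : 2 ^+ 3 = 8 :> R by rewrite -natrX.
  have TL : 0 <= T * ln T by rewrite mulr_ge0 ?(ltW Tpos) //; lra.
  rewrite -!mulrA; move: HT TL; rewrite [T * (2 * _)]mulrCA.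
  move: (X * H) (T * ln T) => u v. lra.
move: (2 ^+ d.+2) C0 => C C0.
have {}d1 : (1 < d)%N by rewrite ltn_neqAle eq_sym d1.
have Hd := @inv_powers_le R d N d1.
have Hdge : 0 <= \sum_(1 <= a < N.+1) ((a%:R : R) ^+ d)^-1.
  by apply: sumr_ge0 => a _; rewrite invr_ge0 exprn_ge0.
have lnN' : 1 + ln (N%:R : R) <= N%:R.
  have := @le_ln1Dx R (N%:R - 1).
  have -> : 1 + (N%:R - 1) = N%:R :> R by ring.
  move=> H.
  by rewrite -lerBrDl H //; lra.
have HT : X * \sum_(1 <= a < N.+1) (a%:R : R)^-1 <= T ^+ d.
  apply: (@le_trans _ _ (T * T)).
    apply: ler_pM; rewrite ?(ltW X0) //.
    by apply: le_trans H1N _; apply: le_trans lnN' _; apply: le_trans NleX _.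
  by rewrite -expr2 ler_weXn2l.
have HX : X ^+ d * \sum_(1 <= a < N.+1) ((a%:R : R) ^+ d)^-1 <= T ^+ d * 2.
  by apply: ler_pM; rewrite ?exprn_ge0 ?(ltW X0).
move: HT HX; rewrite -!mulrA; move: (X * _) (X ^+ d * _) => a b HT HX.
have Td0 : 0 < T ^+ d by rewrite exprn_gt0.
have := ler_wpM2l (ltW C0) HT. lra.
Qed.

Lemma density_char0 d g :
  density 0 d g = (d.+1%:R * zeta d.+1%:R * g%:R)^-1.
Proof. by rewrite /density expr0n /= invr0 subr0 mulr1 mul1r. Qed.

Lemma density_charp p d g : (0 < p)%N ->
  density p d g = (p%:R - 1) / ((p%:R - p%:R ^- d) * d.+1%:R * zeta d.+1%:R * g%:R).
Proof.
move=> p0; have P0 : (p%:R : R) != 0 by rewrite pnatr_eq0 -lt0n.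
rewrite /density; have -> : 1 - p%:R^-1 = (p%:R - 1) / p%:R :> R by field.
have -> : 1 - p%:R ^- d.+1 = (p%:R - p%:R ^- d) / p%:R :> R.
  by rewrite exprS; field; rewrite P0 expf_neq0.
rewrite !invfM invrK.
move: ((p%:R - p%:R ^- d)^-1) ((zeta _)^-1) (d.+1%:R^-1) (g%:R^-1) => a b c u.
by field.
Qed.

End Asymptotics.

(** * Characters, monomial maps and regular functions *)

Section Characters.
Variable K : closedFieldType.

Lemma torus1E n (i : 'I_n) : (1 : Kpow K n) i = 1.
Proof. by rewrite ffunE. Qed.

Lemma torusME n (x y : Kpow K n) i : (x * y) i = x i * y i.
Proof. by rewrite ffunE. Qed.

Lemma torusXE n (x : Kpow K n) m i : (x ^+ m) i = x i ^+ m.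
Proof. by elim: m => [|m IH]; rewrite ?expr0 ?ffunE // !exprS torusME IH. Qed.

Lemma torus_mulC n (x y : Kpow K n) : x * y = y * x.
Proof. by apply/ffunP => i; rewrite !torusME mulrC. Qed.

Lemma torus_exprMn n (x y : Kpow K n) m : (x * y) ^+ m = x ^+ m * y ^+ m.
Proof. by apply/ffunP => i; rewrite torusME !torusXE torusME exprMn. Qed.

Definition chi n (v : 'rV[int]_n) (x : Kpow K n) : K := \prod_i x i ^ v 0 i.

Lemma chi_neq0 n (v : 'rV[int]_n) x : Gm x -> chi v x != 0.
Proof. by move=> xG; apply/prodf_neq0 => i _; rewrite expfz_neq0. Qed.

Lemma chi0 n (x : Kpow K n) : chi 0 x = 1.
Proof. by rewrite /chi big1 // => i _; rewrite mxE expr0z. Qed.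

Lemma chiD n (u v : 'rV[int]_n) x : Gm x -> chi (u + v) x = chi u x * chi v x.
Proof.
by move=> xG; rewrite -big_split; apply: eq_bigr => i _; rewrite mxE expfzDr.
Qed.

Lemma chiZ n (c : int) (v : 'rV[int]_n) x : chi (c *: v) x = chi v x ^ c.
Proof.
rewrite /chi; elim/big_ind2: _ => [|a b a' b' -> ->|i _].
- by rewrite exp1rz.
- by rewrite expfzMl.
- by rewrite mxE mulrC exprz_exp.
Qed.

Lemma chi_delta n (j : 'I_n) (x : Kpow K n) : chi (delta_mx 0 j) x = x j.
Proof.
rewrite /chi (bigD1 j) //= mxE !eqxx expr1z big1 ?mulr1 // => i ij.
by rewrite mxE (negbTE ij) andbF expr0z.
Qed.

Lemma chi_sum n (I : Type) (s : seq I) (F : I -> 'rV[int]_n) x : Gm x ->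
  chi (\sum_(i <- s) F i) x = \prod_(i <- s) chi (F i) x.
Proof.
move=> xG; elim: s => [|i s IH]; first by rewrite !big_nil chi0.
by rewrite !big_cons chiD // IH.
Qed.

Lemma chiM n (v : 'rV[int]_n) x y : chi v (x * y) = chi v x * chi v y.
Proof. by rewrite -big_split; apply: eq_bigr => i _; rewrite ffunE expfzMl. Qed.

Lemma chi1 n (v : 'rV[int]_n) : chi v 1 = 1.
Proof. by rewrite /chi big1 // => i _; rewrite ffunE exp1rz. Qed.

Lemma chiN n (v : 'rV[int]_n) x : chi (- v) x = (chi v x)^-1.
Proof. by rewrite -scaleN1r chiZ. Qed.

Lemma GmM n (x y : Kpow K n) : Gm x -> Gm y -> Gm (x * y).
Proof. by move=> xG yG i; rewrite torusME mulf_neq0. Qed.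

Lemma Gm1 n : Gm (1 : Kpow K n).
Proof. by move=> i; rewrite ffunE oner_eq0. Qed.

Lemma GmX n (x : Kpow K n) m : Gm x -> Gm (x ^+ m).
Proof. by move=> xG i; rewrite torusXE expf_neq0. Qed.

Lemma GmV n (x : Kpow K n) : Gm x -> Gm (coord_inv x).
Proof. by move=> xG i; rewrite ffunE invr_eq0. Qed.

Lemma mul_coord_inv n (x : Kpow K n) : Gm x -> coord_inv x * x = 1.
Proof. by move=> xG; apply/ffunP => i; rewrite !ffunE mulVf. Qed.

Definition monomial_map n r (A : 'M[int]_(n, r)) (z : Kpow K r) : Kpow K n :=
  [ffun j => chi (row j A) z].

Lemma Gm_monomial n r (A : 'M[int]_(n, r)) z : Gm z -> Gm (monomial_map A z).
Proof. by move=> zG j; rewrite ffunE chi_neq0. Qed.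

Lemma chi_monomial n r (A : 'M[int]_(n, r)) v z : Gm z ->
  chi v (monomial_map A z) = chi (v *m A) z.
Proof.
move=> zG; rewrite /(chi v); under eq_bigr do rewrite ffunE -chiZ.
by rewrite -chi_sum // -mulmx_sum_row.
Qed.

Lemma monomial_mapM n r (A : 'M[int]_(n, r)) z w :
  monomial_map A (z * w) = monomial_map A z * monomial_map A w.
Proof. by apply/ffunP => j; rewrite !ffunE chiM. Qed.

Lemma monomial_map1 n r (A : 'M[int]_(n, r)) : monomial_map A 1 = 1.
Proof. by apply/ffunP => j; rewrite !ffunE chi1. Qed.

Lemma monomial_mapX n r (A : 'M[int]_(n, r)) z m :
  monomial_map A (z ^+ m) = monomial_map A z ^+ m.
Proof.
by elim: m => [|m IH]; rewrite ?expr0 ?monomial_map1 // !exprS monomial_mapM IH.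
Qed.

Lemma monomial_map_comp n r s (A : 'M[int]_(n, r)) (B : 'M[int]_(r, s)) z : Gm z ->
  monomial_map A (monomial_map B z) = monomial_map (A *m B) z.
Proof.
by move=> zG; apply/ffunP => j; rewrite !ffunE chi_monomial // row_mul.
Qed.

Lemma monomial_map_id n (z : Kpow K n) : monomial_map 1%:M z = z.
Proof. by apply/ffunP => j; rewrite ffunE row1 chi_delta. Qed.

End Characters.

Section Regular.
Variable K : closedFieldType.

(** The Laurent polynomial functions on the torus: a power of the product of all
    coordinates serves as a common denominator. *)
Definition regular r (h : Kpow K r -> K) := exists (F : mpoly.mpoly r K) (N : nat),
  forall z, Gm z -> h z * (\prod_i z i) ^+ N = mpoly.meval z F.

Lemma prod_coord_neq0 r (z : Kpow K r) : Gm z -> \prod_i z i != 0.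
Proof. by move=> zG; apply/prodf_neq0 => i _; exact: zG. Qed.

Lemma meval_prod_coord r (z : Kpow K r) :
  mpoly.meval z (\prod_i mpoly.mpolyX K (mpoly.mnm1 i)) = \prod_i z i.
Proof. by rewrite rmorph_prod /=; apply: eq_bigr => i _; rewrite mpoly.mevalXU. Qed.

(** Any larger denominator will do, so that finitely many regular functions have
    a common one. *)
Lemma regular_raise r (h : Kpow K r -> K) : regular h ->
  exists N0, forall N, (N0 <= N)%N -> exists F : mpoly.mpoly r K,
    forall z, Gm z -> h z * (\prod_i z i) ^+ N = mpoly.meval z F.
Proof.
move=> [F [N0 FE]]; exists N0 => N NN.
exists (F * (\prod_i mpoly.mpolyX K (mpoly.mnm1 i)) ^+ (N - N0)) => z zG.
by rewrite rmorphM rmorphXn /= meval_prod_coord -FE // -mulrA -exprD subnKC.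
Qed.

Lemma eq_regular r (h h' : Kpow K r -> K) :
  (forall z, Gm z -> h z = h' z) -> regular h -> regular h'.
Proof. by move=> hh' [F [N FE]]; exists F, N => z zG; rewrite -hh' // FE. Qed.

Lemma regular_meval r (F : mpoly.mpoly r K) : regular (fun z => mpoly.meval z F).
Proof. by exists F, 0%N => z _; rewrite expr0 mulr1. Qed.

Lemma regular_const r (c : K) : @regular r (fun=> c).
Proof.
by exists (mpoly.mpolyC r c), 0%N => z _; rewrite mpoly.mevalC expr0 mulr1.
Qed.

Lemma regularD r (h k : Kpow K r -> K) :
  regular h -> regular k -> regular (fun z => h z + k z).
Proof.
move=> /regular_raise[M HM] /regular_raise[N HN].
have [F FE] := HM (maxn M N) (leq_maxl _ _).
have [G GE] := HN (maxn M N) (leq_maxr _ _).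
by exists (F + G), (maxn M N) => z zG; rewrite mpoly.mevalD -FE // -GE // mulrDl.
Qed.

Lemma regularM r (h k : Kpow K r -> K) :
  regular h -> regular k -> regular (fun z => h z * k z).
Proof.
move=> [F [M FE]] [G [N GE]]; exists (F * G), (M + N)%N => z zG.
by rewrite rmorphM /= -FE // -GE // exprD mulrACA.
Qed.

Lemma regularX r (h : Kpow K r -> K) m : regular h -> regular (fun z => h z ^+ m).
Proof.
move=> hr; elim: m => [|m IH]; first exact: regular_const.
by apply: eq_regular (regularM hr IH) => z _; rewrite exprS.
Qed.

Lemma regular_prod r (I : Type) (s : seq I) (P : pred I) (h : I -> Kpow K r -> K) :
  (forall i, regular (h i)) -> regular (fun z => \prod_(i <- s | P i) h i z).
Proof.
move=> hr; elim: s => [|i s IH].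
  by apply: eq_regular (@regular_const r 1) => z _; rewrite big_nil.
have [Pi|Pi] := boolP (P i).
  by apply: eq_regular (regularM (hr i) IH) => z _; rewrite big_cons Pi.
by apply: eq_regular IH => z _; rewrite big_cons (negbTE Pi).
Qed.

Lemma regular_sum r (I : Type) (s : seq I) (P : pred I) (h : I -> Kpow K r -> K) :
  (forall i, regular (h i)) -> regular (fun z => \sum_(i <- s | P i) h i z).
Proof.
move=> hr; elim: s => [|i s IH].
  by apply: eq_regular (@regular_const r 0) => z _; rewrite big_nil.
have [Pi|Pi] := boolP (P i).
  by apply: eq_regular (regularD (hr i) IH) => z _; rewrite big_cons Pi.
by apply: eq_regular IH => z _; rewrite big_cons (negbTE Pi).
Qed.

Lemma regular_coord r (i : 'I_r) : regular (fun z : Kpow K r => z i).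
Proof.
by apply: eq_regular (regular_meval (mpoly.mpolyX K (mpoly.mnm1 i))) => z _;
   rewrite mpoly.mevalXU.
Qed.

Lemma regular_coordV r (i : 'I_r) : regular (fun z : Kpow K r => (z i)^-1).
Proof.
exists (\prod_(j | j != i) mpoly.mpolyX K (mpoly.mnm1 j)), 1%N => z zG.
rewrite expr1 (bigD1 i) //= mulKf //.
by rewrite rmorph_prod /=; apply: eq_bigr => j _; rewrite mpoly.mevalXU.
Qed.

Lemma regular_chi r (v : 'rV[int]_r) : regular (@chi K r v).
Proof.
apply: regular_prod => i; case: (v 0 i) => m.
  exact: regularX (regular_coord i).
by apply: eq_regular (regularX m.+1 (regular_coordV i)) => z _; rewrite NegzE exprVn.
Qed.

Lemma regular_comp n r (f : mpoly.mpoly n K) (h : Kpow K r -> Kpow K n) :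
  (forall i, regular (fun z => h z i)) -> regular (fun z => mpoly.meval (h z) f).
Proof.
move=> hr; apply: (@eq_regular _ (fun z => \sum_(m <- mpoly.msupp f)
    mpoly.mcoeff m f * \prod_i h z i ^+ m i)) => [z _|].
  by rewrite mpoly.mevalE.
apply: regular_sum => m; apply: regularM; first exact: regular_const.
by apply: regular_prod => i; apply: regularX.
Qed.

(** Multiplication by a denominator, which has no zero on the torus, does not
    change the zeros. *)
Lemma closed_zeros n (S : set (Kpow K n -> K)) :
  (forall h, S h -> regular h) ->
  zariski_closed [set x | Gm x /\ forall h, S h -> h x = 0].
Proof.
move=> Sreg.
exists [set F | exists2 h, S h & exists N, forall z, Gm z ->
   h z * (\prod_i z i) ^+ N = mpoly.meval z F].
apply/seteqP; split => x [xG xS]; split=> //.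
  by move=> F [h Sh [N FE]]; rewrite -FE // xS // mul0r.
move=> h Sh; have [F [N FE]] := Sreg h Sh.
have /eqP := xS F (ex_intro2 _ _ h Sh (ex_intro _ N FE)).
by rewrite -FE // mulf_eq0 expf_eq0 (negbTE (prod_coord_neq0 xG)) andbF orbF => /eqP.
Qed.

End Regular.

(** * Linear tori are images of monomial maps *)

Section Irreducible.
Variable K : closedFieldType.

Lemma meval_on_line r (z w : Kpow K r) (F : mpoly.mpoly r K) :
  exists P : {poly K}, forall t,
    P.[t] = mpoly.meval [ffun i => z i + t * (w i - z i)] F.
Proof.
exists (\sum_(m <- mpoly.msupp F) (mpoly.mcoeff m F)%:P
          * \prod_i ((z i)%:P + (w i - z i) *: 'X) ^+ m i) => t.
rewrite mpoly.mevalE horner_sum; apply: eq_bigr => m _.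
rewrite hornerM hornerC horner_prod; congr (_ * _); apply: eq_bigr => i _.
by rewrite horner_exp hornerD hornerC hornerZ hornerX ffunE [t * _]mulrC.
Qed.

(** Along the line through [z1] and [z2] the two functions and the product of the
    coordinates become three nonzero polynomials in one variable; their product
    has a point where it does not vanish, since [K] is infinite. *)
Lemma regular_common_nonzero r (h1 h2 : Kpow K r -> K) z1 z2 :
    regular h1 -> regular h2 -> Gm z1 -> Gm z2 -> h1 z1 != 0 -> h2 z2 != 0 ->
  exists z, [/\ Gm z, h1 z != 0 & h2 z != 0].
Proof.
move=> [F1 [N1 F1E]] [F2 [N2 F2E]] z1G z2G h1z h2z.
pose line t : Kpow K r := [ffun i => z1 i + t * (z2 i - z1 i)].
have line0 : line 0 = z1 by apply/ffunP => i; rewrite ffunE mul0r addr0.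
have line1 : line 1 = z2 by apply/ffunP => i; rewrite ffunE mul1r addrC subrK.
have [P1 P1E] := meval_on_line z1 z2 F1.
have [P2 P2E] := meval_on_line z1 z2 F2.
have [Q QE] := meval_on_line z1 z2 (\prod_i mpoly.mpolyX K (mpoly.mnm1 i)).
have {}QE t : Q.[t] = \prod_i line t i by rewrite QE meval_prod_coord.
have nz (P : {poly K}) t : P.[t] != 0 -> P != 0.
  by apply: contra_neq => ->; rewrite horner0.
have P1nz : P1 != 0.
  by apply: (nz _ 0); rewrite P1E -/(line 0) line0 -F1E // mulf_neq0 ?expf_neq0 ?prod_coord_neq0.
have P2nz : P2 != 0.
  by apply: (nz _ 1); rewrite P2E -/(line 1) line1 -F2E // mulf_neq0 ?expf_neq0 ?prod_coord_neq0.
have Qnz : Q != 0.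
  by apply: (nz _ 0); rewrite QE line0 prod_coord_neq0.
have /closed_nonrootP[t] : P1 * P2 * Q != 0 by rewrite !mulf_neq0.
rewrite /root !hornerM !mulf_eq0 !negb_or QE P1E P2E -/(line t) => /andP[/andP[t1 t2] tQ].
have tG : Gm (line t) by move=> i; move/prodf_neq0: tQ => /(_ i isT).
exists (line t); split=> //.
  by apply: contraNneq t1 => h0; rewrite -F1E // h0 mul0r.
by apply: contraNneq t2 => h0; rewrite -F2E // h0 mul0r.
Qed.

(** The pullbacks of two functions that do not vanish on the image are nonzero at
    a common point. *)
Lemma image_irreducible n r (h : Kpow K r -> Kpow K n) :
  (forall i, regular (fun z => h z i)) -> irreducible [set h z | z in @Gm K r].
Proof.
move=> hr; split; first by exists (h 1); exists 1 => //; exact: Gm1.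
move=> _ _ [S1 ->] [S2 ->] cover; apply: contrapT => /not_orP[no1 no2].
have nonzero S : ~ [set h z | z in @Gm K r] `<=` zero_locus S ->
    exists z F, [/\ Gm z, S F & mpoly.meval (h z) F != 0].
  move=> /existsNP[x /not_implyP[[z zG <-] xS]]; apply: contrapT => H.
  apply: xS; split; first by have [[]|[]] := cover _ (ex_intro2 _ _ z zG erefl).
  move=> F SF; apply: contrapT => /eqP Fx; apply: H; by exists z, F.
have [z1 [F1 [z1G S1F1 F1z]]] := nonzero _ no1.
have [z2 [F2 [z2G S2F2 F2z]]] := nonzero _ no2.
have [z [zG Fz1 Fz2]] := regular_common_nonzero
  (regular_comp F1 hr) (regular_comp F2 hr) z1G z2G F1z F2z.
have [[_ /(_ _ S1F1) H]|[_ /(_ _ S2F2) H]] := cover _ (ex_intro2 _ _ z zG erefl).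
  by rewrite H eqxx in Fz1.
by rewrite H eqxx in Fz2.
Qed.

End Irreducible.

Section TorusStructure.
Variable K : closedFieldType.

(** Dedekind's argument.  If two characters in the sum differ at [h], translating
    the relation by [h] and subtracting a multiple of it eliminates one term, for
    each of the two; both shorter relations hold at [x0] by induction, and together
    they force the original one.  If all characters agree on [G], they agree at
    [x0], where the sum is then a multiple of its value at 1. *)
Lemma character_relation n (G : set (Kpow K n)) (T : eqType)
    (f : T -> Kpow K n -> K) (x0 : Kpow K n) :
    G 1 -> (forall x y, G x -> G y -> G (x * y)) ->
    (forall t, f t 1 = 1) -> (forall t x y, f t (x * y) = f t x * f t y) ->
    (forall t u, (forall x, G x -> f t x = f u x) -> f t x0 = f u x0) ->
  forall (s : seq T) (c : T -> K),
    (forall x, G x -> \sum_(t <- s) c t * f t x = 0) ->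
    \sum_(t <- s) c t * f t x0 = 0.
Proof.
move=> G1 GM f1 fM agree_at s; have [k] := ubnP (size s).
elim: k s => // k IH [|t s] /ltnSE sk c rel; first by rewrite big_nil.
have [agree|] := pselect (forall u, u \in s -> forall x, G x -> f u x = f t x).
  have E u : u \in t :: s -> f u x0 = f t x0.
    by rewrite inE => /predU1P[-> //|us]; apply: agree_at; exact: agree.
  rewrite (eq_big_seq (fun u => c u * f t x0)); last by move=> u us; rewrite E.
  rewrite -mulr_suml; have := rel 1 G1.
  by under eq_bigr do rewrite f1 mulr1; move=> ->; rewrite mul0r.
move=> /existsNP[u /not_implyP[us /existsNP[h /not_implyP[Gh /eqP fuh]]]].
set S := \sum_(_ <- _) _.
have shift v : v \in t :: s ->
    \sum_(i <- t :: s) c i * f i h * f i x0 = f v h * S.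
  move=> vs; apply/eqP; rewrite -subr_eq0 mulr_sumr -sumrB; apply/eqP.
  pose c' i := c i * (f i h - f v h).
  have c'E x : \sum_(i <- t :: s) (c i * f i h * f i x - f v h * (c i * f i x))
      = \sum_(i <- rem v (t :: s)) c' i * f i x.
    rewrite (perm_big _ (perm_to_rem vs)) big_cons /= [X in X + _](_ : _ = 0) ?add0r.
      by apply: eq_bigr => i _; rewrite /c'; ring.
    by ring.
  rewrite c'E; apply: IH => [|x Gx].
    by rewrite size_rem //=; case: (size s) sk.
  rewrite -c'E sumrB -mulr_sumr rel // mulr0 subr0 -[RHS](rel (h * x)).
    by apply: eq_bigr => i _; rewrite fM mulrA.
  exact: GM.
have tt : t \in t :: s by rewrite mem_head.
have us' : u \in t :: s by rewrite in_cons us orbT.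
have /eqP := shift _ us'; rewrite (shift _ tt) -subr_eq0 -mulrBl mulf_eq0.
by rewrite subr_eq0 eq_sym (negbTE fuh) => /eqP.
Qed.

Definition annihilator n (G : set (Kpow K n)) : set 'rV[int]_n :=
  [set v | forall x, G x -> chi v x = 1].

(** A polynomial that vanishes on [G] is a linear relation between the monomial
    characters of [G], and such a relation persists at any point where the
    characters trivial on [G] are trivial. *)
Lemma closed_subgroup_annihilator n (G : set (Kpow K n)) x :
    subgroup G -> zariski_closed G ->
  G x <-> Gm x /\ forall v, annihilator G v -> chi v x = 1.
Proof.
move=> [GGm G1 GM _] [S GS]; split=> [Gx|[xG xv]].
  by split; [exact: GGm | move=> v; apply].
rewrite GS; split=> // F SF; rewrite mpoly.mevalE.
pose f (m : mpoly.multinom n) (y : Kpow K n) := \prod_i y i ^+ m i.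
apply: (@character_relation n G _ f x) => //.
- by move=> m; rewrite /f big1 // => i _; rewrite ffunE expr1n.
- by move=> m y z; rewrite -big_split; apply: eq_bigr => i _; rewrite ffunE exprMn.
- have fE (m : mpoly.multinom n) y : f m y = chi (\row_i (m i)%:Z) y.
    by apply: eq_bigr => i _; rewrite mxE.
  move=> t u tu; rewrite !fE; apply/eqP; rewrite -subr_eq0.
  set a := \row_i _; set b := \row_i _.
  have /xv : annihilator G (a - b).
    move=> y Gy; rewrite chiD ?chiN; last exact: GGm.
    by rewrite -!fE tu // divff // fE chi_neq0 //; exact: GGm.
  rewrite chiD // chiN => ab.
  by rewrite -[chi a x](mulfVK (chi_neq0 b xG)) ab mul1r subrr.
- by move=> y; rewrite GS => -[_ /(_ _ SF)]; rewrite mpoly.mevalE.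
Qed.

(** If [chi v ^+ m] is trivial on [G], write [X^m - 1 = q * (X - 1)^e] with [q] not
    vanishing at 1.  Then [G] is covered by the closed sets [chi v = 1] and
    [q (chi v) = 0], and the second one misses the identity.  The exponent [e]
    may exceed 1 in positive characteristic, where dividing by [X - 1] once would
    not do. *)
Lemma annihilator_saturated n (G : set (Kpow K n)) (k : int) v :
  linear_torus G -> k != 0 -> annihilator G (k *: v) -> annihilator G v.
Proof.
move=> [[GGm G1 GM GV] _ [_ Girr]] k0 kv.
have [m m0 mv] : exists2 m : nat, (0 < m)%N & forall x, G x -> chi v x ^+ m = 1.
  exists `|k|%N; first by rewrite absz_gt0.
  move=> x Gx; have := kv x Gx; rewrite chiZ; case: (k) => // i.
  by rewrite NegzE /= => /(congr1 GRing.inv); rewrite invr1 -exprnN invrK.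
have [e [q]] := multiplicity_XsubC ('X^m - 1%:P : {poly K}) 1.
rewrite -size_poly_eq0 size_XnsubC //= => q1 qE.
have q1' : q.[1] != 0 by [].
have Z1 : zariski_closed [set x : Kpow K n | Gm x /\ forall h, [set fun x => chi v x - 1] h -> h x = 0].
  apply: closed_zeros => _ ->; apply: regularD; first exact: regular_chi.
  exact: regular_const.
have Z2 : zariski_closed [set x : Kpow K n | Gm x /\ forall h, [set fun x => q.[chi v x]] h -> h x = 0].
  apply: closed_zeros => _ ->.
  apply: (@eq_regular _ _ (fun x => \sum_(i < size q) q`_i * chi v x ^+ i)) => [x _|].
    by rewrite horner_coef.
  by apply: regular_sum => i; apply: regularM; [exact: regular_const|apply: regularX; exact: regular_chi].
have [||sub] := Girr _ _ Z1 Z2.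
- move=> x Gx; have := congr1 (fun p => p.[chi v x]) qE.
  rewrite hornerM horner_exp !hornerE mv // subrr => /esym/eqP.
  rewrite mulf_eq0 expf_eq0 => /orP[/eqP qx|/andP[_ /eqP cx]]; [right|left]; split.
  + exact: GGm.
  + by move=> _ ->.
  + exact: GGm.
  + by move=> _ ->.
- by move=> sub x Gx; have [_ /(_ _ erefl) /eqP] := sub x Gx; rewrite subr_eq0 => /eqP.
- have [_ /(_ _ erefl)] := sub _ G1; rewrite chi1 => q0.
  by rewrite q0 eqxx in q1'.
Qed.

(** A matrix of vectors of [L] of maximal rank spans [L] over the rationals.  In its
    Smith form [A *m D *m U] the rows of [U] with a nonzero elementary divisor have
    a multiple in [L], hence lie in [L] by saturation, and they span it. *)
Lemma saturated_lattice n (L : set 'rV[int]_n) :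
    L 0 -> (forall u v, L u -> L v -> L (u + v)) ->
    (forall (k : int) v, L v -> L (k *: v)) ->
    (forall (k : int) v, k != 0 -> L (k *: v) -> L v) ->
  exists (U : 'M[int]_n) (J : {set 'I_n}), U \in unitmx /\
    forall v, L v <-> forall j, j \notin J -> (v *m invmx U) 0 j = 0.
Proof.
move=> L0 LD LZ Lsat.
have Lcomb m (M : 'M[int]_(m, n)) (u : 'rV[int]_m) :
    (forall i, L (row i M)) -> L (u *m M).
  move=> LM; rewrite mulmx_sum_row; elim/big_ind: _ => // i _; exact: LZ.
pose toQ m (M : 'M[int]_(m, n)) : 'M[rat]_(m, n) := map_mx intr M.
pose P k := asbool (exists m (M : 'M[int]_(m, n)),
  (forall i, L (row i M)) /\ \rank (toQ m M) = k).
have exP : exists k, P k.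
  by exists (\rank (toQ 0%N 0)); apply/asboolP; exists 0%N, 0; split=> // -[].
have ubP k : P k -> (k <= n)%N.
  by move=> /asboolP[m [M [_ <-]]]; exact: rank_leq_col.
case: (ex_maxnP exP ubP) => k /asboolP[m [M [LM rM]]] maxk.
have spanM v : L v -> (toQ _ v <= toQ _ M)%MS.
  move=> Lv; have sub : (toQ _ M <= toQ _ (col_mx M v))%MS.
    by rewrite /toQ map_col_mx -addsmxE addsmxSl.
  have : (toQ _ (col_mx M v) <= toQ _ M)%MS.
    rewrite -(mxrank_leqif_sup sub) eqn_leq mxrankS //= rM; apply: maxk.
    apply/asboolP; exists (m + 1)%N, (col_mx M v); split=> // i.
    rewrite -[i]fintype.splitK; case: (fintype.split i) => j /=; rewrite ?rowKu ?rowKd //.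
    by rewrite (_ : row j v = v) //; apply/rowP => l; rewrite mxE ord1.
  by apply: submx_trans; rewrite /toQ map_col_mx -addsmxE addsmxSr.
have [A uA [U uU [d _ MD]]] := int_Smith_normal_form M.
set D := \matrix_(i, j) _ in MD.
exists U, [set j | [exists i, D i j != 0]]%SET; split=> // v; split=> [Lv j|vJ].
  rewrite inE negb_exists => /forallP Dj.
  have /submxP[u uE] := spanM v Lv.
  have : map_mx intr (v *m invmx U) = u *m map_mx intr A *m map_mx intr D :> 'M[rat]_(_, _).
    rewrite map_mxM /= -/(toQ _ v) uE /toQ MD !map_mxM -!mulmxA -map_mxM mulmxV //.
    by rewrite map_mx1 mulmx1.
  move/matrixP => /(_ 0 j); rewrite mxE [RHS]mxE big1 => [/eqP|i _].
    by rewrite intr_eq0 => /eqP.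
  by have := Dj i; rewrite negbK [X in _ * X]mxE => /eqP ->; rewrite mulr0.
have LU j : j \in [set j | [exists i, D i j != 0]]%SET -> L (row j U).
  rewrite inE => /existsP[i]; rewrite mxE => Dij.
  have ij : i = j :> nat by apply/eqP; apply: contraNT Dij => /negbTE ->.
  rewrite ij eqxx mulr1n in Dij.
  apply: (Lsat d`_j) => //.
  have -> : d`_j *: row j U = row i (invmx A) *m M.
    rewrite MD !mulmxA -row_mul mulVmx // -row_mul mul1mx; apply/rowP => l.
    rewrite !mxE (bigD1 j) //= mxE [D i j]mxE ij eqxx big1 ?addr0 // => j' j'j.
    rewrite mxE [D i j']mxE ij (_ : (j == j' :> nat) = false) ?mul0r //.
    by apply/eqP => jj'; rewrite eq_sym -val_eqE /= jj' eqxx in j'j.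
  exact: Lcomb.
rewrite -[v](mulmxKV uU) mulmx_sum_row; elim/big_ind: _ => // j _.
case: (boolP (j \in [set j | [exists i, D i j != 0]]%SET)) => jJ.
  by apply: LZ; exact: LU.
by rewrite vJ // scale0r.
Qed.

(** In the coordinates given by [U], the group [G] is the subtorus on which the
    coordinates in [J] are 1; the remaining ones parametrize it, and the
    corresponding rows [B] of [U] provide the inverse map. *)
Lemma linear_torus_param n (G : set (Kpow K n)) : linear_torus G ->
  exists r (A : 'M[int]_(n, r)) (B : 'M[int]_(r, n)),
    B *m A = 1%:M /\ G = [set monomial_map A z | z in @Gm K r].
Proof.
move=> Gtorus; have [Gsub Gclosed _] := Gtorus; have [GGm _ _ _] := Gsub.
have [||||U [J [uU LJ]]] := @saturated_lattice n (annihilator G).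
- by move=> x _; rewrite chi0.
- by move=> u v Lu Lv x Gx; rewrite chiD ?Lu ?Lv ?mulr1 //; exact: GGm.
- by move=> k v Lv x Gx; rewrite chiZ Lv // exp1rz.
- by move=> k v k0; exact: annihilator_saturated.
pose s (k : 'I_#|~: J|) : 'I_n := enum_val k.
have sJ k : s k \notin J by have := enum_valP k; rewrite inE.
exists #|~: J|, (colsub s (invmx U)), (rowsub s U); split.
  rewrite mul_rowsub_mx mulmx_colsub mulmxV //.
  by apply/matrixP => i j; rewrite !mxE (inj_eq enum_val_inj).
have BV : rowsub s U *m invmx U = rowsub s 1%:M by rewrite mul_rowsub_mx mulmxV.
apply/seteqP; split=> [x Gx|_ [z zG <-]].
  exists (monomial_map (rowsub s U) x); first exact/Gm_monomial/GGm.
  have xG := GGm x Gx.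
  rewrite monomial_map_comp //; apply/ffunP => i; rewrite ffunE.
  rewrite -[RHS]chi_delta -row1; apply/eqP; rewrite -subr_eq0.
  set AB := _ *m _.
  have /(_ x Gx) : annihilator G (row i AB - row i 1%:M).
    apply/LJ => j jJ; rewrite mulmxBl -!row_mul mul1mx mxE.
    have -> : AB *m invmx U = colsub s (invmx U) *m rowsub s 1%:M.
      by rewrite -mulmxA BV.
    have [k jk] : exists k, j = s k.
      have jJ' : j \in ~: J by rewrite inE.
      by exists (enum_rank_in jJ' j); rewrite /s enum_rankK_in.
    rewrite !mxE (bigD1 k) //= !mxE jk eqxx mulr1 big1 ?addr0 ?subrr // => l lk.
    by rewrite !mxE (inj_eq enum_val_inj) (negbTE lk) mulr0.
  rewrite chiD // chiN => ab.
  by rewrite -[chi _ x](mulfVK (chi_neq0 (row i 1%:M) xG)) ab mul1r subrr.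
apply/(closed_subgroup_annihilator _ Gsub Gclosed); split; first exact: Gm_monomial.
move=> v /LJ Lv; rewrite chi_monomial // mulmx_colsub.
by rewrite (_ : colsub s _ = 0) ?chi0 //; apply/rowP => k; rewrite mxE [RHS]mxE Lv.
Qed.

End TorusStructure.

(** * The dimension of a torsion coset *)

Section Independence.
Variable K : closedFieldType.

Lemma irreducible_integral n (X : set (Kpow K n)) (f g : mpoly.mpoly n K) :
    irreducible X -> X `<=` @Gm K n ->
    (forall x, X x -> mpoly.meval x f * mpoly.meval x g = 0) ->
  (forall x, X x -> mpoly.meval x f = 0) \/ (forall x, X x -> mpoly.meval x g = 0).
Proof.
move=> [_ Xirr] XGm fg.
have closed h : zariski_closed (zero_locus [set h : mpoly.mpoly n K]) by exists [set h].
have [x Xx|sub|sub] := Xirr _ _ (closed f) (closed g).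
- move/eqP: (fg x Xx); rewrite mulf_eq0 => /orP[/eqP h0|/eqP h0]; [left|right];
  by split; [exact: XGm | move=> _ ->].
- by left=> x /sub[_]; apply.
- by right=> x /sub[_]; apply.
Qed.

(** The functions [g i] with [i < m] separate the members of the chain and are
    therefore algebraically independent on [F m].  In a relation, divide by the
    largest possible power [k] of the last function: by irreducibility of [F m] the
    quotient [Q] still vanishes there.  On [F m.-1], where the last function
    vanishes, only the terms with exponent exactly [k] survive, and they form a
    relation between one function fewer.  The monomials are indexed by an
    arbitrary finite type, so that this selection of terms is a mere restriction
    to a subset. *)
Lemma chain_independent n (F : nat -> set (Kpow K n)) (g : nat -> mpoly.mpoly n K) m :
    (forall j, (j <= m)%N -> irreducible (F j) /\ F j `<=` @Gm K n) ->
    (forall j, (j < m)%N -> F j `<=` F j.+1) ->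
    (forall j, (j < m)%N -> forall x, F j x -> mpoly.meval x (g j) = 0) ->
    (forall j, (j < m)%N -> exists2 x, F j.+1 x & mpoly.meval x (g j) != 0) ->
  forall (I : finType) (c : I -> K) (e : I -> nat -> nat) (A : {set I}),
    (exists a, a \in A) -> (forall a, a \in A -> c a != 0) ->
    {in A &, forall a b, (forall i, (i < m)%N -> e a i = e b i) -> a = b} ->
  ~ forall x, F m x ->
      \sum_(a in A) c a * \prod_(i < m) mpoly.meval x (g i) ^+ e a i = 0.
Proof.
elim: m => [|m IH] Firr Fsub g0 gn0 I c e A [a0 Aa0] cA einj.
  have [[x Fx] _] := (Firr 0%N (leqnn _)).1.
  move=> /(_ x Fx); rewrite (bigD1 a0) //= big_ord0 mulr1 big1 ?addr0 => [|a /andP[Aa]].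
    by move/eqP; rewrite (negbTE (cA _ Aa0)).
  by rewrite (einj _ _ Aa Aa0) // eqxx.
move=> rel.
pose k := e [arg min_(a < a0 in A) e a m] m.
have [ka Aka kmin] : exists2 a, a \in A & e a m = k /\ forall b, b \in A -> (k <= e b m)%N.
  by rewrite /k; case: arg_minnP => // a Aa amin; exists a.
case: kmin => eka kmin.
pose Q : mpoly.mpoly n K := \sum_(a in A)
  mpoly.mpolyC n (c a) * (\prod_(i < m) g i ^+ e a i * g m ^+ (e a m - k)).
have QE x : mpoly.meval x Q = \sum_(a in A) c a *
    (\prod_(i < m) mpoly.meval x (g i) ^+ e a i * mpoly.meval x (g m) ^+ (e a m - k)).
  rewrite /Q rmorph_sum; apply: eq_bigr => a _; rewrite !rmorphM /= mpoly.mevalC rmorphXn.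
  by rewrite rmorph_prod; congr (_ * (_ * _)); apply: eq_bigr => i _; rewrite rmorphXn.
have [irr sub] := Firr m.+1 (leqnn _).
have [x Fx|gm0|Q0] := irreducible_integral (f := g m ^+ k) (g := Q) irr sub.
- rewrite rmorphXn /= QE mulr_sumr -[RHS](rel x Fx); apply: eq_bigr => a Aa.
  rewrite mulrCA; congr (_ * _); rewrite big_ord_recr /= mulrCA -exprD.
  by rewrite subnKC // kmin.
- have [x Fx gx] := gn0 m (leqnn _); have /eqP := gm0 x Fx.
  by rewrite rmorphXn /= expf_eq0 (negbTE gx) andbF.
apply: (IH _ _ _ _ I c e [set a in A | e a m == k]%SET) => //.
- by move=> j jm; apply: Firr; apply: leqW.
- by move=> j jm; apply: Fsub; apply: leqW.
- by move=> j jm; apply: g0; apply: leqW.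
- by move=> j jm; apply: gn0; apply: leqW.
- by exists ka; rewrite inE Aka eka eqxx.
- by move=> a; rewrite inE => /andP[Aa _]; apply: cA.
- move=> a b; rewrite !inE => /andP[Aa /eqP ea] /andP[Ab /eqP eb] ab.
  apply: einj => // i; rewrite ltnS leq_eqVlt => /predU1P[->|]; last exact: ab.
  by rewrite ea eb.
move=> x Fx; have := Q0 x (Fsub m (leqnn _) x Fx); rewrite QE => Q0x; rewrite -[RHS]Q0x.
rewrite [RHS](bigID (fun a => e a m == k)) /= [X in _ = _ + X]big1 ?addr0.
  apply: eq_big => [a|a]; rewrite inE // => /andP[_ /eqP ->].
  by rewrite subnn mulr1.
move=> a /andP[Aa ak]; rewrite (g0 m) // expr0n subn_eq0.
by rewrite leqNgt ltn_neqAle eq_sym ak kmin //= !mulr0.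
Qed.

(** Exponents are bounded variable by variable, so that the monomials allowed for
    [B] are counted by [B.+1 ^ r]. *)
Definition boxed r (B : nat) (P : mpoly.mpoly r K) :=
  forall m, m \in mpoly.msupp P -> forall i, (m i <= B)%N.

Lemma boxed_exists r (P : mpoly.mpoly r K) : exists B, boxed B P.
Proof.
exists (mpoly.msize P) => m mP i.
apply: leq_trans (ltnW (mpoly.msize_mdeg_lt mP)).
by rewrite mpoly.mdegE (bigD1 i) //= leq_addr.
Qed.

Lemma boxed_le r B B' (P : mpoly.mpoly r K) : (B <= B')%N -> boxed B P -> boxed B' P.
Proof. by move=> BB PB m mP i; apply: leq_trans BB; apply: PB. Qed.

Lemma boxed1 r : boxed 0 (1 : mpoly.mpoly r K).
Proof.
move=> m; rewrite mpoly.mcoeff_msupp mpoly.mcoeff1.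
by have [-> _ i|_] := eqVneq m (mpoly.mnm0); rewrite ?mpoly.mnm0E // eqxx.
Qed.

Lemma boxedM r B C (P Q : mpoly.mpoly r K) :
  boxed B P -> boxed C Q -> boxed (B + C) (P * Q).
Proof.
move=> PB QC m /mpoly.msuppM_le /allpairsP[[u v] /= [uP vQ ->]] i.
by rewrite mpoly.mnmDE leq_add ?PB ?QC.
Qed.

Lemma boxedX r B (P : mpoly.mpoly r K) k : boxed B P -> boxed (B * k) (P ^+ k).
Proof.
move=> PB; elim: k => [|k IH]; first by rewrite muln0 expr0; exact: boxed1.
by rewrite mulnS exprS; exact: boxedM.
Qed.

Lemma boxed_prod r B m (P : 'I_m -> mpoly.mpoly r K) :
  (forall i, boxed B (P i)) -> boxed (m * B) (\prod_i P i).
Proof.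
move=> PB; have -> : (m * B = \sum_(i < m) B)%N by rewrite sum_nat_const card_ord.
apply: (big_ind2 (fun C Q => @boxed r C Q)) => [|C Q C' Q' HQ HQ'|i _].
- exact: boxed1.
- exact: boxedM.
- exact: PB.
Qed.

(** The coefficients of the [P a] are vectors in a space of dimension
    [B.+1 ^ r]; more of them are linearly dependent. *)
Lemma boxed_dependent r B (I : finType) (P : I -> mpoly.mpoly r K) :
    (forall a, boxed B (P a)) -> (B.+1 ^ r < #|I|)%N ->
  exists c : I -> K, (exists a, c a != 0) /\
    \sum_a mpoly.mpolyC r (c a) * P a = 0.
Proof.
move=> PB big.
pose J := {ffun 'I_r -> 'I_B.+1}.
pose mon (j : J) : mpoly.multinom r := mpoly.Multinom [tuple nat_of_ord (j i) | i < r].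
pose M : 'M[K]_(#|I|, #|{: J}|) :=
  \matrix_(a, j) mpoly.mcoeff (mon (enum_val j)) (P (enum_val a)).
have : kermx M != 0.
  rewrite -mxrank_eq0 mxrank_ker subn_eq0 -ltnNge.
  by apply: leq_ltn_trans (rank_leq_col _) _; rewrite card_ffun !card_ord.
move=> /rowV0Pn[u /sub_kermxP uM u0].
exists (fun a => u 0 (enum_rank a)); split.
  move: u0 => /rV0Pn[i ui]; exists (enum_val i); by rewrite enum_valK.
apply/mpoly.mpolyP => m; rewrite mpoly.mcoeff0 raddf_sum /=.
under eq_bigr do rewrite mpoly.mcoeffCM.
case: (boolP [forall i, m i < B.+1]%N) => [/forallP mB|]; last first.
  rewrite negb_forall => /existsP[i]; rewrite -leqNgt => mi.
  rewrite big1 // => a _; rewrite mpoly.memN_msupp_eq0 ?mulr0 //.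
  by apply/negP => /(PB a)/(_ i); rewrite leqNgt mi.
pose j : J := [ffun i => Ordinal (mB i)].
have mj : mon j = m by apply/mpoly.mnmP => i; rewrite mpoly.multinomE tnth_mktuple ffunE.
have /matrixP/(_ 0 (enum_rank j)) := uM; rewrite !mxE => uM0.
rewrite -[RHS]uM0.
rewrite (reindex (fun i : 'I_#|I| => enum_val i)) /=; last first.
  by exists enum_rank => ? _; [exact: enum_valK | exact: enum_rankK].
by apply: eq_bigr => a _; rewrite mxE enum_valK enum_rankK mj.
Qed.

End Independence.

Section Dimension.
Variable K : closedFieldType.

Lemma zariski_closed_Gm n (Z : set (Kpow K n)) : zariski_closed Z -> Z `<=` @Gm K n.
Proof. by move=> [S ->] x []. Qed.

Lemma chain_separators n (X : set (Kpow K n)) m F : irreducible_chain X m F ->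
  exists g : nat -> mpoly.mpoly n K, forall j, (j < m)%N ->
    (forall x, F j x -> mpoly.meval x (g j) = 0) /\
    (exists2 x, F j.+1 x & mpoly.meval x (g j) != 0).
Proof.
move=> [Fcl Flt]; suff /boolp.choice[g gP] : forall j, exists g : mpoly.mpoly n K,
    (j < m)%N -> (forall x, F j x -> mpoly.meval x g = 0) /\
      (exists2 x, F j.+1 x & mpoly.meval x g != 0) by exists g.
move=> j; have [jm|jm] := ltnP j m; last by exists 0.
have [[S FS] _ _] := Fcl j (ltnW jm).
have [/zariski_closed_Gm FGm _ _] := Fcl j.+1 jm.
have [sub /existsNP[x /not_implyP[Fx nFx]]] := Flt j jm.
have [f [Sf fx]] : exists f, S f /\ mpoly.meval x f != 0.
  apply: contrapT => H; apply: nFx; rewrite FS; split; first exact: FGm.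
  by move=> f Sf; apply: contrapT => /eqP fx; apply: H; exists f.
exists f => _; split; last by exists x.
by move=> y; rewrite FS => -[_]; apply.
Qed.

(** Clear the denominators of the separating functions [g j] pulled back by [h].
    Their [N ^ m] monomials with exponents below [N] become polynomials with
    exponents at most [m * B * N], where [B] is independent of [N].  If [r < m],
    these are linearly dependent for large [N], against [chain_independent]. *)
Lemma chain_length_le n r (h : Kpow K r -> Kpow K n) m F :
    (forall i, regular (fun z => h z i)) ->
    irreducible_chain [set h z | z in @Gm K r] m F ->
  (m <= r)%N.
Proof.
move=> hr chF; have [g gP] := chain_separators chF; case: chF => Fcl Flt.
rewrite leqNgt; apply/negP => rm.
have /boolp.choice[N0 N0P] j := regular_raise (regular_comp (g j) hr).
pose N1 := (\sum_(i < m) N0 i)%N.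
have le_N1 (j : 'I_m) : (N0 j <= N1)%N by rewrite /N1 (bigD1 j) //= leq_addr.
have /boolp.choice[P PE] (j : 'I_m) := N0P j N1 (le_N1 j).
pose X : mpoly.mpoly r K := \prod_i mpoly.mpolyX K (mpoly.mnm1 i).
have /boolp.choice[b bP] j := boxed_exists (P j).
have [bX XB] := boxed_exists (X ^+ N1).
pose B := (bX + \sum_i b i)%N.
have PB j : boxed B (P j).
  apply: boxed_le (bP j); rewrite /B (bigD1 j) //=; lia.
have {}XB : boxed B (X ^+ N1) by apply: boxed_le XB; rewrite leq_addr.
(* [(C * N) ^ r < N ^ r.+1 <= N ^ m] once [C ^ r < N]. *)
pose C := (m * B).+1; pose N := (C ^ r).+1.
pose I := {ffun 'I_m -> 'I_N}.
pose Q (a : I) := \prod_i (P i ^+ a i * (X ^+ N1) ^+ (N - a i)).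
have QB a : boxed (m * (B * N)) (Q a).
  apply: boxed_prod => i.
  have -> : (B * N = B * a i + B * (N - a i))%N by rewrite -mulnDr subnKC // ltnW.
  by apply: boxedM; apply: boxedX.
have big : ((m * (B * N)).+1 ^ r < #|{: I}|)%N.
  rewrite card_ffun !card_ord; apply: (@leq_ltn_trans ((C * N) ^ r)).
    case: (r) => // r'; rewrite leq_exp2r // /C mulSnr mulnA -addn1.
    by rewrite leq_add2l.
  rewrite expnMn; apply: (@leq_trans (N ^ r.+1)); last by rewrite leq_pexp2l.
  by rewrite expnS ltn_pmul2r // expn_gt0.
have [c [[a0 ca0] rel]] := boxed_dependent QB big.
pose e (a : I) (i : nat) : nat := oapp (fun k : 'I_m => nat_of_ord (a k)) 0%N (insub i).
have eE a (i : 'I_m) : e a i = a i by rewrite /e valK.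
have QE a z : Gm z -> mpoly.meval z (Q a) =
    (\prod_(i < m) mpoly.meval (h z) (g i) ^+ e a i) * (\prod_i z i) ^+ (N1 * N * m).
  move=> zG; rewrite rmorph_prod /=.
  have -> : (\prod_i z i) ^+ (N1 * N * m) = \prod_(j < m) (\prod_i z i) ^+ (N1 * N).
    by rewrite prodr_const card_ord -exprM.
  rewrite -big_split; apply: eq_bigr => i _ /=.
  rewrite rmorphM !rmorphXn /= meval_prod_coord -PE // exprMn -mulrA -!exprM -exprD.
  by rewrite eE -mulnDr subnKC // ltnW.
apply: (@chain_independent K n F g m _ _ _ _ I c e [set a | c a != 0]%SET).
- by move=> j jm; have [cl irr _] := Fcl j jm; split=> //; exact: zariski_closed_Gm.
- by move=> j jm; have [] := Flt j jm.
- by move=> j jm; have [] := gP j jm.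
- by move=> j jm; have [] := gP j jm.
- by exists a0; rewrite inE.
- by move=> a; rewrite inE.
- move=> a a' _ _ ab; apply/ffunP => i; apply: val_inj; by rewrite /= -!eE ab.
move=> x Fx; have [_ _ /(_ _ Fx)[z zG <-]] := Fcl m (leqnn _).
have /(congr1 (mpoly.meval z)) := rel.
rewrite rmorph0 rmorph_sum /= (eq_bigr (fun a => c a *
    \prod_(i < m) mpoly.meval (h z) (g i) ^+ e a i * (\prod_i z i) ^+ (N1 * N * m))); last first.
  by move=> a _; rewrite rmorphM /= mpoly.mevalC QE // mulrA.
rewrite -mulr_suml => /eqP; rewrite mulf_eq0 expf_eq0 (negbTE (prod_coord_neq0 zG)) andbF orbF.
move=> /eqP rel0; rewrite -[RHS]rel0 big_mkcond; apply: eq_bigr => a _; rewrite inE.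
by case: eqP => [->|//]; rewrite mul0r.
Qed.

Lemma monomial_map_pid r i (z : Kpow K r) j :
  monomial_map (pid_mx i) z j = if (j < i)%N then z j else 1.
Proof.
rewrite ffunE; case: ifP => ji.
  rewrite (_ : row j _ = delta_mx 0 j) ?chi_delta //.
  by apply/rowP => k; rewrite !mxE eqxx ji andbT eq_sym.
by rewrite (_ : row j _ = 0) ?chi0 //; apply/rowP => k; rewrite !mxE ji andbF.
Qed.

Lemma exists_not01 : exists c : K, c != 0 /\ c != 1.
Proof.
have /closed_nonrootP[c] : 'X * ('X - 1%:P) != 0 :> {poly K}.
  by rewrite mulf_neq0 ?polyX_eq0 ?polyXsubC_eq0.
by rewrite rootM negb_or rootX root_XsubC => /andP[c0 c1]; exists c.
Qed.

Lemma regular_monomial n r (y : Kpow K n) (A : 'M[int]_(n, r)) i :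
  regular (fun z => (y * monomial_map A z) i).
Proof.
apply: (@eq_regular _ _ (fun z => y i * chi (row i A) z)) => [z _|].
  by rewrite !ffunE.
by apply: regularM; [exact: regular_const|exact: regular_chi].
Qed.

(** The members of the chain are the images [F i] of the coordinate subtori of
    [G_m^r] on which the coordinates from [i] on are 1.  Each [F i] is the set of
    fixed points of a retraction given by monomials, hence closed. *)
Lemma torus_coset_chain n r (y : Kpow K n) (A : 'M[int]_(n, r)) (B : 'M[int]_(r, n)) :
    Gm y -> B *m A = 1%:M ->
  exists F, irreducible_chain [set y * monomial_map A z | z in @Gm K r] r F.
Proof.
move=> yG BA; pose p i : 'M[int]_r := pid_mx i.
pose F i := [set y * monomial_map (A *m p i) z | z in @Gm K r].
have retract i z : Gm z -> monomial_map B (coord_inv y * (y * monomial_map (A *m p i) z))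
    = monomial_map (p i) z.
  by move=> zG; rewrite mulrA mul_coord_inv // mul1r monomial_map_comp // mulmxA BA mul1mx.
exists F; split=> [i le_ir|i ir]; [split|split].
(* [h j] compares the [j]-th coordinates of [x] and of its retract. *)
- pose h j x := (y * monomial_map (A *m p i *m B) (coord_inv y * x)) j - x j.
  have -> : F i = [set x | Gm x /\ forall g, range h g -> g x = 0].
    apply/seteqP; split=> [_ [z zG <-]|x [xG xh]].
      split; first by apply: GmM => //; exact: Gm_monomial.
      move=> _ [j _ <-]; apply/eqP; rewrite /h subr_eq0; apply/eqP; congr ((y * _) j).
      rewrite -monomial_map_comp ?retract //; last first.
        apply: GmM; first exact: GmV.
        by apply: GmM => //; exact: Gm_monomial.
      by rewrite monomial_map_comp // -mulmxA mul_pid_mx minnn (minn_idPr le_ir).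
    exists (monomial_map B (coord_inv y * x)).
      by apply: Gm_monomial; apply: GmM => //; exact: GmV.
    rewrite monomial_map_comp; last by apply: GmM => //; exact: GmV.
    apply/ffunP => j; apply/eqP; rewrite -subr_eq0; apply/eqP.
    exact: (xh (h j) (ex_intro2 _ _ j Logic.I erefl)).
  apply: closed_zeros => _ [j _ <-]; apply: regularD.
    apply: (eq_regular (h := fun x => (y * monomial_map (A *m p i *m B) (coord_inv y)
             * monomial_map (A *m p i *m B) x) j)) => [x _|]; last exact: regular_monomial.
    by rewrite monomial_mapM mulrA.
  apply: (eq_regular (h := fun x => -1 * x j)) => [x _|]; first by rewrite mulN1r.
  by apply: regularM; [exact: regular_const|exact: regular_coord].
- by apply: image_irreducible => j; exact: regular_monomial.
- move=> _ [z zG <-]; exists (monomial_map (p i) z); first exact: Gm_monomial.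
  by rewrite monomial_map_comp.
- move=> _ [z zG <-]; exists (monomial_map (p i) z); first exact: Gm_monomial.
  rewrite monomial_map_comp // -mulmxA mul_pid_mx.
  by rewrite (minn_idPr (leqnSn i)) (minn_idPr (ltnW ir)).
have [c [c0 c1]] := exists_not01.
pose z : Kpow K r := [ffun j => c].
have zG : Gm z by move=> j; rewrite ffunE.
move=> /(_ (y * monomial_map (A *m p i.+1) z)); case; first by exists z.
move=> w wG /(congr1 (fun x => monomial_map B (coord_inv y * x))).
rewrite !retract // => /ffunP/(_ (Ordinal ir)); rewrite !monomial_map_pid ltnn /= ltnSn ffunE.
by move=> /esym/eqP; rewrite (negbTE c1).
Qed.

Lemma torus_coset_dim n r (y : Kpow K n) (A : 'M[int]_(n, r)) (B : 'M[int]_(r, n)) d :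
    Gm y -> B *m A = 1%:M ->
  has_dim [set y * monomial_map A z | z in @Gm K r] d -> d = r.
Proof.
move=> yG BA [[F chF] dmax]; apply/eqP; rewrite eqn_leq.
rewrite (chain_length_le (regular_monomial y A) chF) /=.
by have [F' chF'] := torus_coset_chain yG BA; exact: dmax chF'.
Qed.

End Dimension.

(** * Torsion points of a coset *)

Section Torsion.
Variables (K : closedFieldType) (p : nat).
Hypothesis pP : p = 0%N \/ prime p.
Hypothesis charK : forall m, (m%:R == 0 :> K) = (p %| m)%N.

Lemma has_order_dvd n (x : Kpow K n) m k :
  has_order x m -> (x ^+ k == 1) = (m %| k)%N.
Proof.
move=> [_ m0 xm xmin]; apply/eqP/idP => [xk|/dvdnP[q ->]]; last first.
  by rewrite mulnC exprM xm expr1n.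
rewrite /dvdn; apply: contraT; rewrite -lt0n => r0.
have := xmin _ r0; rewrite leqNgt ltn_pmod // => H; apply: H.
by move: xk; rewrite [in X in X -> _](divn_eq k m) exprD mulnC exprM xm expr1n mul1r.
Qed.

Lemma has_order_exists n (x : Kpow K n) k : Gm x -> (0 < k)%N -> x ^+ k = 1 ->
  exists2 m, has_order x m & (m <= k)%N.
Proof.
move=> xG k0 xk; have ex : exists m, (0 < m)%N && (x ^+ m == 1) by exists k; rewrite k0 xk eqxx.
case: (ex_minnP ex) => m /andP[m0 /eqP xm] mmin; exists m; last by rewrite mmin // k0 xk eqxx.
by split=> // j j0 xj; rewrite mmin // j0 xj eqxx.
Qed.

(** In characteristic [p], [x ^+ (p * q) = 1] implies [x ^+ q = 1], since the
    Frobenius map is injective. *)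
Lemma has_order_char n (x : Kpow K n) m : has_order x m -> ~~ (p %| m)%N.
Proof.
move=> [xG m0 xm xmin]; apply/negP => /dvdnP[q mE].
case: pP => [p0|pp]; first by rewrite mE p0 muln0 in m0.
have pchK : p \in [pchar K] by rewrite inE pp /= charK dvdnn.
have q0 : (0 < q)%N by move: m0; rewrite mE muln_gt0 => /andP[].
have /(xmin q q0) : x ^+ q = 1.
  apply/ffunP => i; have /ffunP/(_ i) := xm; rewrite !torusXE torus1E mE exprM => xi.
  have := pFrobenius_autB_comm pchK (commr1 (x i ^+ q)).
  rewrite !pFrobenius_autE xi expr1n subrr => /eqP.
  by rewrite expf_eq0 subr_eq0 => /andP[_ /eqP].
by rewrite mE leqNgt ltn_Pmulr ?prime_gt1.
Qed.

Lemma roots_of_unity m : ~~ (p %| m)%N -> exists s : seq K,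
  [/\ uniq s, size s = m & forall t, (t \in s) = (t ^+ m == 1)].
Proof.
move=> pm; have m0 : (0 < m)%N by case: m pm; rewrite ?dvdn0.
have [s sE] := closed_field_poly_normal ('X^m - 1 : {poly K}).
have mon : lead_coef ('X^m - 1 : {poly K}) = 1.
  by apply/monicP; exact: monicXnsubC.
rewrite mon scale1r in sE; exists s; split.
- by rewrite -separable_prod_XsubC -sE separable_Xn_sub_1 // charK.
- by apply: succn_inj; rewrite -(size_prod_XsubC _ id) -sE size_XnsubC.
- move=> t; rewrite -root_prod_XsubC -sE rootE !hornerE subr_eq0 //.
Qed.

Lemma root_exists m (a : K) : (0 < m)%N -> exists t, t ^+ m = a.
Proof.
move=> m0; have /closed_rootP[t] : size ('X^m - a%:P : {poly K}) != 1%N.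
  by rewrite size_XnsubC // eqSS -lt0n.
by rewrite rootE !hornerE subr_eq0 => /eqP ta; exists t.
Qed.

Section Coset.
Variables (n r g : nat) (y : Kpow K n) (A : 'M[int]_(n, r)) (B : 'M[int]_(r, n)).
Hypothesis BA : B *m A = 1%:M.
Let C := [set y * monomial_map A z | z in @Gm K r].
Hypothesis yg : has_order y g.
Hypothesis gmin : forall x m, C x -> has_order x m -> (g <= m)%N.

Let yG : Gm y. Proof. by case: yg. Qed.
Let g0 : (0 < g)%N. Proof. by case: yg. Qed.

Lemma param_inj : {in @Gm K r &, injective (monomial_map A)}.
Proof.
move=> z w; rewrite !inE => zG wG /(congr1 (monomial_map B)).
by rewrite !monomial_map_comp // BA !monomial_map_id.
Qed.

(** Let [e] be the gcd of [m] and [g].  Since [y ^+ m] and [y ^+ g] lie in the group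
    [G] of which [C] is a coset, so does [y ^+ e]; extracting an [e]-th root in the
    divisible group [G] yields a point of [C] with [e]-th power 1.  By minimality
    [g <= e], so that [g = e]. *)
Lemma coset_exponent_dvd x m : C x -> (0 < m)%N -> x ^+ m = 1 -> (g %| m)%N.
Proof.
move=> [z0 z0G <-] m0; rewrite torus_exprMn -monomial_mapX => ym.
have [km kn kE _] := egcdnP g m0; set e := gcdn m g in kE.
have e0 : (0 < e)%N by rewrite gcdn_gt0 m0.
have ymE : y ^+ m = monomial_map A (coord_inv (z0 ^+ m)).
  rewrite -[LHS]mulr1 -(monomial_map1 K A).
  rewrite -(mul_coord_inv (GmX m z0G)) monomial_mapM [X in _ * X]torus_mulC mulrA ym.
  by rewrite mul1r.
pose w := coord_inv (z0 ^+ m) ^+ km.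
have wG : Gm w by apply: GmX; apply: GmV; apply: GmX.
have yeE : y ^+ e = monomial_map A w.
  rewrite monomial_mapX -ymE -exprM mulnC kE exprD mulnC exprM.
  by have [_ _ -> _] := yg; rewrite expr1n mul1r.
have /boolp.choice[t tE] (i : 'I_r) : exists t, t ^+ e = (w i)^-1 by apply: root_exists.
pose z := [ffun i => t i] : Kpow K r.
have zw : z ^+ e = coord_inv w by apply/ffunP => i; rewrite torusXE !ffunE.
have zG : Gm z.
  move=> i; have : (z ^+ e) i != 0 by rewrite zw; exact: GmV.
  by rewrite torusXE expf_eq0 e0.
have xe : (y * monomial_map A z) ^+ e = 1.
  by rewrite torus_exprMn -monomial_mapX yeE zw -monomial_mapM torus_mulC mul_coord_inv // monomial_map1.
have [e' oe' e'e] := has_order_exists (GmM yG (Gm_monomial A zG)) e0 xe.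
have ge : (g <= e)%N by apply: leq_trans e'e; apply: gmin oe'; exists z.
have eg : (e %| g)%N := dvdn_gcdr m g.
have -> : g = e by apply/eqP; rewrite eqn_leq ge dvdn_leq.
exact: dvdn_gcdl.
Qed.

(** As [y ^+ m = 1], these are the translates by [y] of the points of [G] of exponent
    [m], that is, the images of the [r]-tuples of [m]-th roots of unity. *)
Lemma coset_exponent_points m : (g %| m)%N -> ~~ (p %| m)%N ->
  exists U : seq (Kpow K n), [/\ uniq U, size U = (m ^ r)%N &
    forall x, x \in U <-> C x /\ x ^+ m = 1].
Proof.
move=> gm pm; have m0 : (0 < m)%N by case: (m) pm; rewrite ?dvdn0.
have [s [us ss sE]] := roots_of_unity pm.
have ym : y ^+ m = 1 by apply/eqP; rewrite (has_order_dvd _ yg).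
pose pt (a : {ffun 'I_r -> 'I_m}) : Kpow K r := [ffun i => s`_(a i)].
have pts (a : {ffun 'I_r -> 'I_m}) i : s`_(a i) \in s by rewrite mem_nth ?ss.
have ptG a : Gm (pt a).
  move=> i; rewrite ffunE; have := pts a i; rewrite sE; apply: contraTneq => ->.
  by rewrite expr0n eqn0Ngt m0 eq_sym oner_eq0.
have pt_inj : injective pt.
  move=> a a' /ffunP aa'; apply/ffunP => i; have := aa' i; rewrite !ffunE => /eqP.
  by rewrite nth_uniq ?ss // => /eqP /val_inj.
exists [seq y * monomial_map A (pt a) | a : {ffun 'I_r -> 'I_m}]; split.
- rewrite map_inj_uniq ?enum_uniq // => a a' /(congr1 (fun x => coord_inv y * x)).
  rewrite !mulrA mul_coord_inv // !mul1r => /param_inj; rewrite !inE => H.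
  by apply: pt_inj; apply: H.
- by rewrite size_map -cardT card_ffun !card_ord.
move=> x; split=> [/mapP[a _ ->]|[[z zG <-]]].
  split; first by exists (pt a).
  rewrite torus_exprMn ym mul1r -monomial_mapX (_ : pt a ^+ m = 1) ?monomial_map1 //.
  by apply/ffunP => i; rewrite torusXE !ffunE; apply/eqP; rewrite -sE.
rewrite torus_exprMn ym mul1r -monomial_mapX -(monomial_map1 K A) => /param_inj.
rewrite !inE => /(_ (GmX m zG) (@Gm1 K r)) zm.
have zs i : z i \in s by rewrite sE -torusXE zm torus1E.
have zlt i : (index (z i) s < m)%N by rewrite -ss index_mem.
apply/mapP; exists [ffun i => Ordinal (zlt i)]; first by rewrite mem_enum.
by congr (_ * monomial_map A _); apply/ffunP => i; rewrite !ffunE /= nth_index.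
Qed.

End Coset.
End Torsion.

(** * Counting torsion points by their order *)

Section Count.
Variables (R : realType) (K : closedFieldType) (p : nat).
Hypothesis pP : p = 0%N \/ prime p.
Hypothesis charK : forall m, (m%:R == 0 :> K) = (p %| m)%N.

Lemma sum_eq_index N c k0 (P : pred nat) : (0 < c)%N -> (0 < k0 <= N)%N ->
  \sum_(1 <= j < N.+1 | P j) ((c * k0 == c * j)%N%:R : R) = (P k0)%:R.
Proof.
move=> c0 /andP[k00 k0N].
rewrite big_mkcond (bigD1_seq k0) ?iota_uniq ?mem_index_iota ?k00 //=.
rewrite big1 ?addr0 => [|j jk]; first by rewrite eqxx; case: (P k0).
by rewrite eqn_pmul2l // eq_sym (negbTE jk) if_same.
Qed.

(** Here [e k] is the number of points of order [g * k]: the points of order at most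
    [T] have order [g * k] with [0 < k <= N] and [k] prime to the characteristic, and
    those of order [g * j] with [j] dividing [k] are the points of exponent
    [g * k]. *)
Lemma torsion_count n d g (C : set (Kpow K n)) (T : R) N :
    torsion_coset C -> has_dim C d -> has_coset_order C g ->
    N%:R <= T / g%:R < N.+1%:R ->
  finite_set (torsion_upto C T) /\ exists e : nat -> R,
    #|` fset_set (torsion_upto C T)|%:R = \sum_(1 <= k < N.+1 | ~~ (p %| k)%N) e k /\
    forall k, (0 < k <= N)%N -> ~~ (p %| k)%N ->
      \sum_(1 <= j < N.+1 | (j %| k)%N) e j = (g * k)%:R ^+ d.
Proof.
move=> [z [G [_ Gtor CE]]] Cdim [[y Cy yg] gmin] /andP[NT TN].
have [r [A [B [BA GE]]]] := linear_torus_param Gtor.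
have [yG g0 _ _] := yg.
have G0 : (0 : R) < g%:R by rewrite ltr0n.
have {}CE : C = [set y * monomial_map A w | w in @Gm K r].
  move: Cy; rewrite CE GE => -[_ [w wG <-] yE].
  apply/seteqP; split=> [_ [_ [u uG <-] <-]|_ [u uG <-]].
    exists (coord_inv w * u); first by apply: GmM => //; exact: GmV.
    by rewrite -yE -mulrA -monomial_mapM mulrA [w * _]torus_mulC
      mul_coord_inv // mul1r.
  exists (monomial_map A (w * u)); first by exists (w * u) => //; exact: GmM.
  by rewrite -yE monomial_mapM mulrA.
have dr : d = r by move: Cdim; rewrite CE; exact: (torus_coset_dim yG BA).
rewrite CE in gmin Cdim *; rewrite {d}dr in Cdim *.
set C' := [set _ | _ in _] in gmin *.
have C'G x : C' x -> Gm x by move=> [w wG <-]; apply: GmM => //; exact: Gm_monomial.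
have pgk k : ~~ (p %| k)%N -> ~~ (p %| g * k)%N.
  by move=> pk; rewrite (dvdn_mulP pP) negb_or pk andbT (has_order_char pP charK yg).
have /boolp.choice[U UP] k : exists U : seq (Kpow K n), ~~ (p %| k)%N ->
    [/\ uniq U, size U = ((g * k) ^ r)%N & forall x, x \in U <-> C' x /\ x ^+ (g * k) = 1].
  have [pk|] := boolP (p %| k)%N; first by exists [::].
  move=> pk; have [U UP] := coset_exponent_points charK BA yg (dvdn_mulr k (dvdnn g)) (pgk k pk).
  by exists U.
have ordg x m : C' x -> has_order x m -> m%:R <= T ->
    exists k, [/\ m = (g * k)%N, (0 < k <= N)%N & ~~ (p %| k)%N].
  move=> Cx xm mT; have [_ m0 xm1 _] := xm.
  have /dvdnP[k mE] := coset_exponent_dvd yg gmin Cx m0 xm1.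
  exists k; rewrite mulnC; split=> //.
    move: m0; rewrite mE muln_gt0 => /andP[-> _] /=.
    rewrite -ltnS -(ltr_nat R); apply: le_lt_trans TN.
    by rewrite ler_pdivlMr // -natrM -mE.
  by apply: contra (has_order_char pP charK xm) => pk; rewrite mE dvdn_mulr.
have fin : finite_set (torsion_upto C' T).
  apply: (@sub_finite_set _ _ [set` flatten [seq U k | k <- iota 1 N & ~~ (p %| k)%N]]);
    last exact: finite_seq.
  move=> x [Cx [m xm mT]]; have [k [mE k0 pk]] := ordg x m Cx xm mT.
  apply/flattenP; exists (U k).
    by apply/mapP; exists k; rewrite // mem_filter pk mem_iota add1n ltnS.
  have [_ _ /(_ x) [_]] := UP k pk; apply; split=> //.
  by have [_ _ <- _] := xm; rewrite mE.
split=> //.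
have /boolp.choice[od oP] (x : Kpow K n) : exists m, forall j, has_order x j -> has_order x m.
  have [[j xj]|no] := pselect (exists j, has_order x j); first by exists j.
  by exists 0%N => j xj; case: no; exists j.
set F := fset_set _.
have FP x : x \in F -> exists2 k, [/\ C' x, has_order x (od x) & od x = (g * k)%N] & (0 < k <= N)%N /\ ~~ (p %| k)%N.
  rewrite in_fset_set // inE => -[Cx [m xm mT]].
  have ox := oP x m xm; have om : od x = m.
    have [_ o0 xo omin] := ox; have [_ m0 xm1 mmin] := xm.
    by apply/eqP; rewrite eqn_leq omin ?mmin.
  by have [k [mE k0 pk]] := ordg x m Cx xm mT; exists k; rewrite ?om.
exists (fun k => \sum_(x <- F) (od x == g * k)%N%:R); split.
  rewrite exchange_big /= (eq_big_seq (fun=> 1)).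
    by rewrite big_const_seq count_predT iter_addr_0.
  by move=> x /FP[k [_ _ ->] [kN pk]]; rewrite sum_eq_index ?pk.
move=> k kN pk; rewrite exchange_big /=.
have [uU sU UE] := UP k pk.
rewrite (eq_big_seq (fun x => (x \in U k)%:R)); last first.
  move=> x /FP[k' [Cx ox oE] [k'N _]]; rewrite oE sum_eq_index //; congr (_%:R).
  rewrite -(dvdn_pmul2l g0) -oE -(has_order_dvd _ ox).
  by congr nat_of_bool; apply/eqP/idP => [xk|/UE[]//]; apply/UE.
rewrite -natrX -sU -natr_sum; congr (_%:R).
have -> : (\sum_(x <- F) (x \in U k) = count (mem (U k)) F)%N.
  by rewrite -sum1_count [RHS]big_mkcond; apply: eq_bigr => x _ /=; case: (x \in U k).
rewrite -size_filter; apply/perm_size/uniq_perm => //; first exact/filter_uniq/fset_uniq.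
move=> x; rewrite mem_filter /= andb_idr // => /UE[Cx xgk].
rewrite in_fset_set // inE; split=> //.
have gk0 : (0 < g * k)%N by rewrite muln_gt0 g0; case/andP: kN.
have [m xm mgk] := has_order_exists (C'G x Cx) gk0 xgk.
exists m => //; apply: (@le_trans _ _ (g%:R * N%:R)).
  by rewrite -natrM ler_nat (leq_trans mgk) // leq_mul2l; case/andP: kN => _ ->; rewrite orbT.
by rewrite mulrC -ler_pdivlMr.
Qed.

End Count.

Theorem theorem1p4 (R : realType) (d g : nat) (d_ge1 : (1 <= d)%N) :
  (exists M T0 : R,
     forall (K : closedFieldType) (n : nat) (C : set (Kpow K n)),
       [pchar K] =i pred0 ->
       torsion_coset C -> has_dim C d -> has_coset_order C g ->
       forall T : R, T0 <= T ->
         finite_set (torsion_upto C T) /\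
         `| #|` fset_set (torsion_upto C T)|%:R
            - T ^+ d.+1 / (d.+1%:R * zeta d.+1%:R * g%:R) |
           <= M * error_term d T)
  /\
  (exists M T0 : R,
     forall (p : nat) (K : closedFieldType) (n : nat) (C : set (Kpow K n)),
       p \in [pchar K] ->
       torsion_coset C -> has_dim C d -> has_coset_order C g ->
       forall T : R, T0 <= T ->
         finite_set (torsion_upto C T) /\
         `| #|` fset_set (torsion_upto C T)|%:R
            - (p%:R - 1) * T ^+ d.+1
              / ((p%:R - p%:R ^- d) * d.+1%:R * zeta d.+1%:R * g%:R) |
           <= M * error_term d T).
Proof.
have main : exists M T0 : R, forall p (K : closedFieldType) (n : nat) (C : set (Kpow K n)),
    p = 0%N \/ prime p -> (forall m, (m%:R == 0 :> K) = (p %| m)%N) ->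
    torsion_coset C -> has_dim C d -> has_coset_order C g ->
    forall T : R, T0 <= T ->
      finite_set (torsion_upto C T) /\
      `| #|` fset_set (torsion_upto C T)|%:R - T ^+ d.+1 * density R p d g |
        <= M * error_term d T.
  (* No point has order 0. *)
  case: (posnP g) => [->|g0].
    exists 0, 0 => p K n C _ _ _ _ [[x _ [_]]]; by rewrite ltnn.
  have [M [T0 MT]] := sieve_error_term R d_ge1 g0.
  exists M, (Num.max T0 0) => p K n C pP charK Ctor Cdim Cord T.
  rewrite ge_max => /andP[T0T Tge0].
  have NX : (Num.truncn (T / g%:R))%:R <= T / g%:R < (Num.truncn (T / g%:R)).+1%:R.
    by rewrite truncn_itv // divr_ge0.
  have [fin [e [-> eP]]] := torsion_count pP charK Ctor Cdim Cord NX.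
  by split=> //; apply: MT.
have [M [T0 MT]] := main.
split; exists M, T0.
  move=> K n C charK Ctor Cdim Cord T T0T.
  have char0 m : (m%:R == 0 :> K) = (0 %| m)%N by rewrite dvd0n; exact: (pcharf0P K).1.
  have := MT 0%N K n C (or_introl erefl) char0 Ctor Cdim Cord T T0T.
  by rewrite density_char0.
move=> p K n C charK Ctor Cdim Cord T T0T.
have [pp _] := andP charK.
have charp m : (m%:R == 0 :> K) = (p %| m)%N by rewrite (dvdn_pcharf charK).
have := MT p K n C (or_intror pp) charp Ctor Cdim Cord T T0T.
by rewrite density_charp ?prime_gt0 // mulrA [T ^+ _ * _]mulrC.
Qed.
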